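(* Let $r\ge 2$ and let $G=H_r$ be the Houghton group on $r$ rays. Then for every non-trivial finitely generated group $H$, the group $G\ast H$ has a Schreier growth gap $n^2$.
   Context: Houghton group. For $r\ge 2$, let $\Xi_r$ be the graph obtained by gluing $r$ infinite rays $\ell_1,\dots,\ell_r$ at their origin. $H_r$ is the group of all permutations $g$ of the vertex set of $\Xi_r$ for which there exist finite subsets $E,F$ of vertices such that for every $i$, $g|_{\ell_i\setminus E}$ is an isometry onto $\ell_i\setminus F$. (So $H_2$ is the group of permutations of $\mathbb{Z}$ that coincide with a translation outside a finite set.) $H_r$ is finitely generated for $r\ge2$. Growth of actions. Let $L$ be a finitely generated group with a finite symmetric generating set $S$, and let $B_L(n)$ be the ball of radius $n$ around the identity for the word metric of $S$. For an $L$-set $X$ (not assumed transitive), put $\mathrm{vol}_{L,X}(n)=\max_{x\in X}|B_L(n)\cdot x|$. For functions $f_1,f_2$, write $f_1(n)\preccurlyeq f_2(n)$ (equivalently $f_2\succcurlyeq f_1$) if there is a positive integer $C$ such that $f_1(n)\le C f_2(Cn)$ for all $n\ge 1$. $L$ has a Schreier growth gap $f(n)$ if every faithful $L$-set $X$ satisfies $\mathrm{vol}_{L,X}(n)\succcurlyeq f(n)$. *)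

(* Defs.v *)
From HB Require Import structures.
From mathcomp Require Import all_boot monoid generic_quotient.
From mathcomp Require Import finmap.
From mathcomp Require Import mathcomp_extra boolp classical_sets functions.
From mathcomp Require Import cardinality.
From mathcomp Require Import zify.

Set Implicit Arguments.
Unset Strict Implicit.
Unset Printing Implicit Defensive.

Local Open Scope quotient_scope.
Local Open Scope classical_set_scope.
Local Open Scope group_scope.

(* Groups are the (possibly infinite) [groupType]s of mathcomp.boot.monoid.   *)

Definition ball (L : groupType) (S : seq L) (n : nat) : set L :=
  [set \prod_(s <- w) s
    | w in [set w : seq L | (size w <= n)%N /\ {subset w <= S}]].

Definition symmetric_generating (L : groupType) (S : seq L) : Prop :=
  (forall s, s \in S -> s^-1 \in S) /\ (forall g, exists n, ball S n g).

Definition finitely_generated (L : groupType) : Prop :=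
  exists S : seq L, symmetric_generating S.

Record gset (L : groupType) (X : Type) := GSet {
  act :> L -> X -> X;
  _ : forall x, act 1 x = x;
  _ : forall g h x, act (g * h) x = act g (act h x)
}.

Definition faithful_gset (L : groupType) (X : Type) (a : gset L X) : Prop :=
  forall g, (forall x, a g x = x) -> g = 1.

(* The largest element of a set of naturals (0 if there is none).             *)
Definition maxset_nat (A : set nat) : nat :=
  xget 0%N [set m | A m /\ forall k, A k -> (k <= m)%N].

(* The orbit pieces B(n).x are finite and their cardinals are bounded by      *)
(* that of B(n), so the maximum is attained whenever X is inhabited.          *)
Definition vol (L : groupType) (S : seq L) (X : choiceType) (a : gset L X)
    (n : nat) : nat :=
  maxset_nat (range (fun x : X => #|` fset_set [set a g x | g in ball S n]|)).

Definition growth_le (f1 f2 : nat -> nat) : Prop :=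
  exists C : nat, (0 < C)%N /\
    forall n, (1 <= n)%N -> (f1 n <= C * f2 (C * n))%N.

(* Growth gaps are only defined for finitely generated groups, so finite      *)
(* generation is a clause of the definition; without it the second clause     *)
(* could hold vacuously.                                                      *)
Definition schreier_growth_gap (L : groupType) (f : nat -> nat) : Prop :=
  finitely_generated L /\
  forall S : seq L, symmetric_generating S ->
  forall (X : choiceType) (a : gset L X), faithful_gset a ->
    growth_le f (vol S a).

(* The free product is the quotient of the monoid of words in the disjoint    *)
(* union of G and H by the congruence that evaluates products, and the        *)
(* identity, inside each factor.                                              *)

Section FreeProduct.
Variables G H : groupType.

Notation word := (seq (G + H)%type).

Inductive fp_equiv : word -> word -> Prop :=
  | fp_refl u : fp_equiv u u
  | fp_sym u v : fp_equiv u v -> fp_equiv v u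
  | fp_trans v u w : fp_equiv u v -> fp_equiv v w -> fp_equiv u w
  | fp_cat u u' v v' :
      fp_equiv u u' -> fp_equiv v v' -> fp_equiv (u ++ v) (u' ++ v')
  | fp_inl1 : fp_equiv [:: inl 1] [::]
  | fp_inr1 : fp_equiv [:: inr 1] [::]
  | fp_inlM x y : fp_equiv [:: inl x; inl y] [:: inl (x * y)]
  | fp_inrM x y : fp_equiv [:: inr x; inr y] [:: inr (x * y)].

Definition fp_rel : rel word := fun u v => `[< fp_equiv u v >].

Lemma fp_relP : equiv_class_of fp_rel.
Proof.
split=> [u|u v|v u w]; first exact/asboolP/fp_refl.
- by apply/asboolP/asboolP => /fp_sym.
- by move=> /asboolP uv /asboolP vw; apply/asboolP/(fp_trans uv).
Qed.

Canonical fp_equiv_rel := EquivRelPack fp_relP.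

Definition free_product : Type := {eq_quot fp_equiv_rel}.

HB.instance Definition _ := Choice.on free_product.
HB.instance Definition _ := EqQuotient.on free_product.

Implicit Types p q : free_product.

Definition fp_letter_inv (x : G + H) : G + H :=
  match x with inl g => inl g^-1 | inr h => inr h^-1 end.
Definition fp_word_inv (u : word) : word := rev (map fp_letter_inv u).

Definition fp_one : free_product := \pi_free_product [::].
Definition fp_mul p q : free_product := \pi_free_product (repr p ++ repr q).
Definition fp_inv p : free_product := \pi_free_product (fp_word_inv (repr p)).

Lemma fp_piP (u v : word) :
  \pi_free_product u = \pi_free_product v <-> fp_equiv u v.
Proof.
split; first by move/eqquotP/asboolP.
by move=> uv; apply/eqquotP/asboolP.
Qed.

Lemma fp_reprK (u : word) : fp_equiv (repr (\pi_free_product u)) u.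
Proof. by apply/fp_piP; rewrite reprK. Qed.

Lemma fp_mulE (u v : word) :
  fp_mul (\pi_free_product u) (\pi_free_product v) = \pi_free_product (u ++ v).
Proof. by apply/fp_piP; apply: fp_cat; exact: fp_reprK. Qed.

Lemma fp_ind (P : free_product -> Prop) :
  (forall u, P (\pi_free_product u)) -> forall p, P p.
Proof. by move=> Ppi p; rewrite -[p]reprK. Qed.

Lemma fp_mulA : associative fp_mul.
Proof.
elim/fp_ind=> u; elim/fp_ind=> v; elim/fp_ind=> w.
by rewrite (fp_mulE v w) (fp_mulE u v) !fp_mulE catA.
Qed.

Lemma fp_mul1 : left_id fp_one fp_mul.
Proof. by elim/fp_ind=> u; rewrite fp_mulE. Qed.

Lemma fp_mulr1 : right_id fp_one fp_mul.
Proof. by elim/fp_ind=> u; rewrite fp_mulE cats0. Qed.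

Lemma fp_letterV x : fp_equiv [:: fp_letter_inv x; x] [::].
Proof.
case: x => [g|h] /=.
- by apply: fp_trans (fp_inlM _ _) _; rewrite mulVg; exact: fp_inl1.
- by apply: fp_trans (fp_inrM _ _) _; rewrite mulVg; exact: fp_inr1.
Qed.

Lemma fp_wordV u : fp_equiv (fp_word_inv u ++ u) [::].
Proof.
elim: u => [|x u IH]; first exact: fp_refl.
rewrite /fp_word_inv map_cons rev_cons cat_rcons -/(fp_word_inv u).
apply: fp_trans IH; apply: fp_cat; first exact: fp_refl.
rewrite -[[:: _, _ & _]]/([:: fp_letter_inv x; x] ++ u) -[X in fp_equiv _ X]cat0s.
by apply: fp_cat; [exact: fp_letterV | exact: fp_refl].
Qed.

Lemma fp_word_invK : involutive fp_word_inv.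
Proof.
move=> u; rewrite /fp_word_inv map_rev revK mapK //.
by case=> x /=; rewrite invgK.
Qed.

Lemma fp_mulV : left_inverse fp_one fp_inv fp_mul.
Proof.
move=> p; rewrite -[X in fp_mul _ X]reprK fp_mulE.
exact/fp_piP/fp_wordV.
Qed.

Lemma fp_mulrV : right_inverse fp_one fp_inv fp_mul.
Proof.
move=> p; rewrite -[X in fp_mul X _]reprK fp_mulE.
apply/fp_piP; rewrite -[X in fp_equiv (X ++ _)]fp_word_invK.
exact: fp_wordV.
Qed.

HB.instance Definition _ := isGroup.Build free_product
  fp_mulA fp_mul1 fp_mulr1 fp_mulV fp_mulrV.

End FreeProduct.

Section Houghton.
Variable r : nat.

(* Vertices of Xi_r: [None] is the common origin of the rays, [Some (i, k)]   *)
(* is the vertex at distance k + 1 from it on the ray i.                      *)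
Definition xi_vertex : Type := option ('I_r * nat).

Definition ray_pt (i : 'I_r) (n : nat) : xi_vertex :=
  if n is k.+1 then Some (i, k) else None.

Definition ray (i : 'I_r) : set xi_vertex := range (ray_pt i).

Definition xi_adj : rel xi_vertex := fun u v =>
  `[< exists i n, (u = ray_pt i n /\ v = ray_pt i n.+1) \/
                  (v = ray_pt i n /\ u = ray_pt i n.+1) >].

(* Graph distance in Xi_r, see [xi_distP].                                    *)
Definition xi_dist (u v : xi_vertex) : nat :=
  match u, v with
  | None, None => 0
  | None, Some (_, k) | Some (_, k), None => k.+1
  | Some (i, k), Some (j, l) =>
      if i == j then (k - l) + (l - k) else k.+1 + l.+1
  end.

Lemma xi_dist_same i m n :
  xi_dist (ray_pt i m) (ray_pt i n) = ((m - n) + (n - m))%N.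
Proof. by case: m n => [|m] [|n] //=; rewrite ?eqxx; lia. Qed.

Lemma xi_dist_diff i j m n :
  i != j -> xi_dist (ray_pt i m) (ray_pt j n) = (m + n)%N.
Proof. by case: m n => [|m] [|n] //= /negPf ij; rewrite ?ij //; lia. Qed.

Lemma xi_ray_pt (i0 : 'I_r) u : exists i m, u = ray_pt i m.
Proof.
by case: u => [[i k]|]; [exists i, k.+1 | exists i0, 0%N].
Qed.

Lemma xi_dist_adj u w v : xi_adj u w -> (xi_dist u v <= (xi_dist w v).+1)%N.
Proof.
move=> /asboolP[i [m uw]]; have [j [l ->]] := xi_ray_pt i v.
have [<-|ij] := eqVneq i j.
  by case: uw => -[-> ->]; rewrite !xi_dist_same; lia.
by case: uw => -[-> ->]; rewrite !xi_dist_diff //; lia.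
Qed.

Lemma xi_dist_next u v d : xi_dist u v = d.+1 ->
  exists w, xi_adj u w /\ xi_dist w v = d.
Proof.
have up i m : xi_adj (ray_pt i m) (ray_pt i m.+1).
  by apply/asboolP; exists i, m; left.
have down i m : xi_adj (ray_pt i m.+1) (ray_pt i m).
  by apply/asboolP; exists i, m; right.
have same i m n : xi_dist (ray_pt i m) (ray_pt i n) = d.+1 ->
    exists w, xi_adj (ray_pt i m) w /\ xi_dist w (ray_pt i n) = d.
  rewrite xi_dist_same => mnd; have [mn|nm] := ltnP m n.
    by exists (ray_pt i m.+1); split=> //; rewrite xi_dist_same; lia.
  case: m mnd nm => [|m] mnd nm; first by lia.
  by exists (ray_pt i m); split=> //; rewrite xi_dist_same; lia.
case: u v => [[i k]|] [[j l]|] //.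
- have [<-|ij] := eqVneq i j; first exact: (same i k.+1 l.+1).
  rewrite (@xi_dist_diff i j k.+1 l.+1) // => kld.
  exists (ray_pt i k); split; first exact: (down i k).
  by rewrite (@xi_dist_diff i j k l.+1) //; lia.
- exact: (same i k.+1 0).
- exact: (same j 0%N l.+1).
Qed.

Lemma xi_distP (u v : xi_vertex) (n : nat) :
  (xi_dist u v <= n)%N <->
  exists p, [/\ path xi_adj u p, last u p = v & (size p <= n)%N].
Proof.
split.
  move dE : (xi_dist u v) => d; elim: d u n dE => [|d IH] u n dE dn.
    exists [::]; split=> //=; move: dE.
    case: u v => [[i k]|] [[j l]|] //=.
    by case: eqP => // -> kl; congr (Some (_, _)); lia.
  have [w [uw wd]] := xi_dist_next dE.
  case: n dn => // n dn; have [p [wp pv pn]] := IH w n wd dn.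
  by exists (w :: p); split=> //=; rewrite uw.
move=> [p [up <- pn]]; apply: leq_trans pn.
elim: p u up => [|w p IH] u /=; last first.
  by move=> /andP[uw /IH wp]; apply: leq_trans (xi_dist_adj _ uw) _.
by case: u => [[i k]|] //= _; rewrite eqxx; lia.
Qed.

Definition houghton_perm (g : xi_vertex -> xi_vertex) : Prop :=
  bijective g /\
  exists E F : set xi_vertex, [/\ finite_set E, finite_set F &
    forall i : 'I_r,
      g @` (ray i `\` E) = ray i `\` F /\
      (forall u v, (ray i `\` E) u -> (ray i `\` E) v ->
         xi_dist (g u) (g v) = xi_dist u v)].

Record houghton := Houghton {
  houghton_fun :> xi_vertex -> xi_vertex;
  _ : `[< houghton_perm houghton_fun >]
}.

HB.instance Definition _ := [isSub for houghton_fun].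
HB.instance Definition _ := [Choice of houghton by <:].

Implicit Types g h : houghton.

Lemma houghtonP g : houghton_perm g.
Proof. by case: g => g /= /asboolP. Qed.

Lemma houghton_perm_id : houghton_perm id.
Proof.
split; first by exists id.
exists set0, set0; split=> [||i]; try exact: finite_set0.
by rewrite image_id.
Qed.

Lemma houghton_perm_comp (g h : xi_vertex -> xi_vertex) :
  houghton_perm g -> houghton_perm h -> houghton_perm (g \o h).
Proof.
move=> [bg [E [F [fE fF gEF]]]] [bh [E' [F' [fE' fF' hEF]]]].
have ig := bij_inj bg; have ih := bij_inj bh.
split; first exact: bij_comp.
exists (E' `|` h @^-1` E), (F `|` g @` F'); split.
- rewrite finite_setU; split=> //; apply: finite_preimage => // x y _ _.
  exact: ih.
- by rewrite finite_setU; split=> //; exact: finite_image.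
- move=> i; have [gi dg] := gEF i; have [hi dh] := hEF i.
  have hE u : (ray i `\` (E' `|` h @^-1` E)) u ->
      (ray i `\` E') u /\ (ray i `\` E) (h u).
    move=> [iu /not_orP[E'u Ehu]]; split=> //; split=> //.
    have: (ray i `\` F') (h u) by rewrite -hi; exists u.
    by case.
  split.
    apply/seteqP; split=> [_ [u + <-]|y [iy /not_orP[Fy gF'y]]].
      move=> /hE[iE'u iEhu].
      have [ig' Fg]: (ray i `\` F) (g (h u)) by rewrite -gi; exists (h u).
      split=> // -[//|[z F'z /ig zhu]].
      have: (ray i `\` F') (h u) by rewrite -hi; exists u.
      by rewrite -zhu => -[].
    have: (ray i `\` F) y by [].
    rewrite -gi => -[z [iz Ez] zy].
    have: (ray i `\` F') z by split=> // F'z; apply: gF'y; exists z.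
    rewrite -hi => -[u [iu E'u] uz].
    by exists u; [split=> // -[//|]; rewrite /= uz | rewrite /= uz].
  move=> u v /hE[E'u Eu] /hE[E'v Ev].
  by rewrite /= dg // dh.
Qed.

Lemma houghton_perm_can (g g' : xi_vertex -> xi_vertex) :
  cancel g g' -> cancel g' g -> houghton_perm g -> houghton_perm g'.
Proof.
move=> gK g'K [_ [E [F [fE fF gEF]]]]; split; first by exists g.
exists F, E; split=> // i; have [gi dg] := gEF i.
have g'F u : (ray i `\` F) u -> (ray i `\` E) (g' u).
  by rewrite -gi => -[v Ev <-]; rewrite gK.
split.
  apply/seteqP; split=> [_ [u Fu <-]|u Eu]; first exact: g'F.
  by exists (g u); rewrite ?gK // -gi; exists u.
by move=> u v /g'F Eu /g'F Ev; rewrite -dg // !g'K.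
Qed.

Definition houghton_one : houghton := Houghton (asboolT houghton_perm_id).

Definition houghton_mul g h : houghton :=
  Houghton (asboolT (houghton_perm_comp (houghtonP g) (houghtonP h))).

Definition houghton_inv_fun g (y : xi_vertex) : xi_vertex :=
  xget None [set x | g x = y].

Lemma houghton_invrK g : cancel (houghton_inv_fun g) g.
Proof.
move=> y; have [[g' gK g'K] _] := houghtonP g.
by rewrite /houghton_inv_fun; case: xgetP => [x _ //|/(_ (g' y))[]]; exact: g'K.
Qed.

Lemma houghton_invK g : cancel g (houghton_inv_fun g).
Proof.
have [bg _] := houghtonP g.
by move=> x; apply: (bij_inj bg); rewrite houghton_invrK.
Qed.

Definition houghton_inv g : houghton :=
  Houghton (asboolT (houghton_perm_can (houghton_invK g) (houghton_invrK g)
    (houghtonP g))).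

Lemma houghton_mulA : associative houghton_mul.
Proof. by move=> f g h; exact: val_inj. Qed.

Lemma houghton_mul1 : left_id houghton_one houghton_mul.
Proof. by move=> g; exact: val_inj. Qed.

Lemma houghton_mulr1 : right_id houghton_one houghton_mul.
Proof. by move=> g; exact: val_inj. Qed.

Lemma houghton_mulV : left_inverse houghton_one houghton_inv houghton_mul.
Proof. by move=> g; apply/val_inj/funext => x /=; rewrite houghton_invK. Qed.

Lemma houghton_mulrV : right_inverse houghton_one houghton_inv houghton_mul.
Proof. by move=> g; apply/val_inj/funext => x /=; rewrite houghton_invrK. Qed.

HB.instance Definition _ := isGroup.Build houghton
  houghton_mulA houghton_mul1 houghton_mulr1 houghton_mulV houghton_mulrV.

End Houghton.

(* Main.v *)
Require Import Defs.
From mathcomp Require Import finmap boolp classical_sets functions cardinality.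
From mathcomp Require Import all_boot monoid generic_quotient fingroup perm.
From mathcomp Require Import zify.

(** Let G be the Houghton group, h a non-trivial element of H and tau the
    3-cycle of the first three vertices 0, 1, 2 of a ray.  In the free product,
    the element z = tau (h^-1 tau h) has infinite order (zigzag_expg_neq1).  In
    a faithful action z therefore has arbitrarily long orbits.  At each step of
    such an orbit, tau or its conjugate moves the point, so a ball of radius
    O(n) contains a set Z of n points that are all moved by tau
    (moved_points).

    It remains to see that moving these n points around with elements of G of
    length O(n) produces n^2 points.  All transpositions of the vertices
    0, ..., q of the ray have length O(q) in G (ball_swap), so with q = 12 n
    the question is one about actions of a finite symmetric group
    (many_points).  To a point x one attaches an equivalence relation on the
    vertices: i and j are linked if some 3-cycle through i and j fixes x.  It is
    equivariant, and tau moves x only if 0, 1, 2 are not all linked.  There are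
    three cases.

    - If no class of some x in Z contains more than half of the vertices, then
      the 3-cycles (y z o) with o fixed and y linked neither to z nor to o send
      x to at least n^2 points.  Indeed, if two of them agree at x, then their
      quotient fixes x; when they share y or z this quotient is a 3-cycle that
      links y to z or to o, and when three of them are disjoint apart from o a
      word in the quotients is again such a 3-cycle (cyc3_word).
    - If some x in Z has a class with more than half of the vertices and at
      least two vertices outside it, exchanging these two with two vertices of
      the class gives at least n^2 different relations, hence points.
    - Otherwise each x in Z has a class missing exactly one vertex, which is 0,
      1 or 2.  Carrying this triple to 4 n disjoint triples gives 4 n points
      for each x, and the missing vertex of the image tells the triple.  This is
      the only case where all points of Z are needed; the points of Z then
      behave like vertices of the graph on which G is defined.

    Finite generation of the free product follows from that of the factors; a
    Houghton group is generated by the shifts towards one ray and a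
    transposition (Gen_all). *)

Set Implicit Arguments.
Unset Strict Implicit.
Unset Printing Implicit Defensive.
Local Open Scope quotient_scope.
Local Open Scope group_scope.

(** * Fibres and 3-cycles *)

(** All lower bounds on numbers of points below come from here: a map with
    small fibres has a large image. *)
Lemma card_le_fibres (I : finType) (Y : eqType) (phi : I -> Y) (c : nat)
    (s : seq Y) (A : {set I}) :
  {in A, forall i, phi i \in s} ->
  {in A, forall i, #|[set j in A | phi j == phi i]| <= c} ->
  #|A| <= c * size s.
Proof.
elim: s A => [|y s IH] A phis fib.
  rewrite muln0 leqn0 cards_eq0; apply/eqP/setP=> i; rewrite inE.
  by apply/negP => /phis.
rewrite -(cardsID [set i | phi i == y]) /= mulnS; apply: leq_add.
  have [->|[i]] := set_0Vmem (A :&: [set i | phi i == y]); first by rewrite cards0.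
  rewrite !inE => /andP[iA /eqP iy]; apply: leq_trans (fib i iA).
  by apply/subset_leq_card/subsetP => j; rewrite !inE iy.
apply: IH => i; rewrite !inE => /andP[iy iA].
  by have := phis i iA; rewrite inE (negPf iy).
apply: leq_trans (fib i iA); apply/subset_leq_card/subsetP => j.
by rewrite !inE => /andP[/andP[_ ->] ->].
Qed.

Section ThreeCycles.
Variable T : finType.
Implicit Types (i j k : T) (s t : {perm T}).

Definition cyc3 i j k : {perm T} := tperm i j * tperm i k.

Lemma cyc3V i j k : (cyc3 i j k)^-1 = cyc3 i k j.
Proof. by rewrite /cyc3 invMg !tpermV. Qed.

Lemma cyc3J i j k s : cyc3 i j k ^ s = cyc3 (s i) (s j) (s k).
Proof. by rewrite /cyc3 conjMg !tpermJ. Qed.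

Lemma cyc3_1 i j k : i != j -> k != j -> cyc3 i j k i = j.
Proof. by move=> ij kj; rewrite permM tpermL tpermD. Qed.

Lemma cyc3_2 i j k : cyc3 i j k j = k.
Proof. by rewrite permM tpermR tpermL. Qed.

Lemma cyc3_3 i j k : i != k -> j != k -> cyc3 i j k k = i.
Proof. by move=> ik jk; rewrite permM (@tpermD _ i j k) // tpermR. Qed.

Lemma cyc3D i j k v : i != v -> j != v -> k != v -> cyc3 i j k v = v.
Proof. by move=> iv jv kv; rewrite permM !tpermD. Qed.

Lemma cyc3C i j k : i != j -> i != k -> j != k -> cyc3 i j k = cyc3 j k i.
Proof.
move=> ij ik jk; apply/permP=> v.
have [<-|iv] := eqVneq i v; first by rewrite cyc3_1 // 1?eq_sym // cyc3_3 // eq_sym.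
have [<-|jv] := eqVneq j v; first by rewrite cyc3_2 cyc3_1.
have [<-|kv] := eqVneq k v; first by rewrite cyc3_2 cyc3_3.
by rewrite !cyc3D.
Qed.

(** With permutations acting on the right, the quotient of the 3-cycles
    (x y o) and (x' y' o) is the 5-cycle (x y y' x' o). *)
Lemma cyc3_quot x y x' y' o : uniq [:: x; y; x'; y'; o] ->
  let s := cyc3 x y o * (cyc3 x' y' o)^-1 in
  [/\ s x = y, s y = y', s y' = x', s x' = o & s o = x].
Proof.
rewrite /= !inE !negb_or -!andbA.
move=> /and5P[xy xx' xy' xo /and5P[yx' yy' yo x'y' /and3P[x'o y'o _]]].
rewrite cyc3V ![(cyc3 x y o * _) _]permM cyc3_1 // 1?eq_sym // cyc3_2 cyc3_2 cyc3_3 //.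
rewrite ![cyc3 x y o _]cyc3D // 1?eq_sym //.
by split; rewrite ?cyc3_1 ?cyc3_3 ?cyc3D // eq_sym.
Qed.

Lemma cyc3_quotD x y x' y' o v : v \notin [:: x; y; x'; y'; o] ->
  (cyc3 x y o * (cyc3 x' y' o)^-1) v = v.
Proof.
rewrite /= !inE !negb_or => /and5P[vx vy vx' vy' vo].
by rewrite cyc3V [LHS]permM !cyc3D // eq_sym.
Qed.

(** The two 5-cycles s and r share the points x1, y1 and o; then s^2 r is a
    product of a 3-cycle and two transpositions, so that its square is a
    3-cycle.  Hence a permutation group containing the quotients of three
    3-cycles which have only o in common contains one of these 3-cycles. *)
Lemma cyc3_word x1 y1 x2 y2 x3 y3 o : uniq [:: x1; y1; x2; y2; x3; y3; o] ->
  let s := cyc3 x1 y1 o * (cyc3 x2 y2 o)^-1 in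
  let r := cyc3 x1 y1 o * (cyc3 x3 y3 o)^-1 in
  (s * s * r) ^+ 2 = cyc3 x3 y3 o.
Proof.
move=> U s r; rewrite expgS expg1.
have [] := @cyc3_quot x1 y1 x2 y2 o.
  by apply: subseq_uniq U; apply/subseqP; exists [:: true; true; true; true; false; false; true].
rewrite -/s => s1 s2 s3 s4 s5.
have [] := @cyc3_quot x1 y1 x3 y3 o.
  apply: subseq_uniq U; apply/subseqP; exists [:: true; true; false; false; true; true; true] => //.
rewrite -/r => r1 r2 r3 r4 r5.
have sD v : v \notin [:: x1; y1; x2; y2; o] -> s v = v by exact: cyc3_quotD.
have rD v : v \notin [:: x1; y1; x3; y3; o] -> r v = v by exact: cyc3_quotD.
move: (U); rewrite /= !inE !negb_or -!andbA.
move=> /and5P[n1 n2 n3 n4 /and5P[n5 n6 n7 n8 /and5P[n9 n10 n11 n12 /and5P[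
  n13 n14 n15 n16 /and5P[n17 n18 n19 n20 /andP[n21 _]]]]]].
have sx3 : s x3 = x3.
  by apply: sD; rewrite !inE !negb_or; apply/and5P; split; rewrite // eq_sym.
have sy3 : s y3 = y3.
  by apply: sD; rewrite !inE !negb_or; apply/and5P; split; rewrite // eq_sym.
have rx2 : r x2 = x2.
  by apply: rD; rewrite !inE !negb_or; apply/and5P; split; rewrite // eq_sym.
have ry2 : r y2 = y2.
  by apply: rD; rewrite !inE !negb_or; apply/and5P; split; rewrite // eq_sym.
(* as variables, s and r are not unfolded by permM *)
clearbody s r.
apply/permP=> v; rewrite [LHS]permM !(permM (s * s)) !(permM s).
have E := (s1, s2, s3, s4, s5, r1, r2, r3, r4, r5, sx3, sy3, rx2, ry2).
have [->|v1] := eqVneq v x1; first by rewrite !E cyc3D // eq_sym.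
have [->|v2] := eqVneq v y1; first by rewrite !E cyc3D // eq_sym.
have [->|v3] := eqVneq v x2; first by rewrite !E cyc3D // eq_sym.
have [->|v4] := eqVneq v y2; first by rewrite !E cyc3D // eq_sym.
have [->|v5] := eqVneq v x3; first by rewrite !E cyc3_1 // eq_sym.
have [->|v6] := eqVneq v y3; first by rewrite !E cyc3_2.
have [->|v7] := eqVneq v o; first by rewrite !E cyc3_3.
have sv : s v = v by apply: sD; rewrite !inE !negb_or v1 v2 v3 v4 v7.
have rv : r v = v by apply: rD; rewrite !inE !negb_or v1 v2 v5 v6 v7.
by rewrite !sv !rv !sv !rv cyc3D // eq_sym.
Qed.

End ThreeCycles.

(** * Points moved by a finite symmetric group *)

Section Partition.
Variables (T : finType) (X : choiceType) (ra : X -> {perm T} -> X).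
Hypothesis ra1 : forall x, ra x 1 = x.
Hypothesis raM : forall x s t, ra x (s * t) = ra (ra x s) t.
Implicit Types (x y : X) (i j k l : T) (s t : {perm T}).

Lemma raK s : cancel (ra^~ s) (ra^~ s^-1).
Proof. by move=> x; rewrite -raM mulgV ra1. Qed.

Lemma fixV x s : ra x s = x -> ra x s^-1 = x.
Proof. by move=> {1}<-; rewrite raK. Qed.

Lemma fixM x s t : ra x s = x -> ra x t = x -> ra x (s * t) = x.
Proof. by move=> xs xt; rewrite raM xs xt. Qed.

Lemma fixJ x s t : (ra (ra x t) (s ^ t) == ra x t) = (ra x s == x).
Proof. by rewrite -raM -conjgC raM (can_eq (raK t)). Qed.

Lemma fix_quot x s t : ra x s = ra x t -> ra x (s * t^-1) = x.
Proof. by move=> st; rewrite raM st raK. Qed.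

(** Classes are singletons or have at least three elements; in the latter case
    they are the maximal sets all of whose even permutations fix x.  The model
    to keep in mind is a point x with the same stabiliser as some i in a large
    T: its classes are {i} and the rest. *)
Definition linked x i j : bool :=
  (i == j) || [exists k, [&& k != i, k != j & ra x (cyc3 i j k) == x]].

Lemma linkedP x i j : i != j ->
  reflect (exists k, [/\ k != i, k != j & ra x (cyc3 i j k) = x]) (linked x i j).
Proof.
move=> ij; rewrite /linked (negPf ij) /=; apply: (iffP existsP) => -[k].
  by case/and3P=> ki kj /eqP ?; exists k.
by case=> ki kj xk; exists k; rewrite ki kj xk eqxx.
Qed.

Lemma linked_cyc x i j k : i != j -> i != k -> j != k ->
  ra x (cyc3 i j k) = x -> [/\ linked x i j, linked x j k & linked x i k].
Proof.
move=> ij ik jk xijk.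
have ji : j != i by rewrite eq_sym.
have ki : k != i by rewrite eq_sym.
have kj : k != j by rewrite eq_sym.
split.
- by apply/linkedP=> //; exists k.
- by apply/linkedP=> //; exists i; rewrite -cyc3C.
- apply/linkedP=> //; exists j; split=> //; rewrite -cyc3V; exact: fixV.
Qed.

Lemma linked_refl x i : linked x i i.
Proof. by rewrite /linked eqxx. Qed.

Lemma linked_sym x i j : linked x i j = linked x j i.
Proof.
suff h a b : linked x a b -> linked x b a by apply/idP/idP; apply: h.
have [->//|ab] := eqVneq a b.
case/(linkedP _ ab) => k [ka kb xk].
have ak : a != k by rewrite eq_sym.
have bk : b != k by rewrite eq_sym.
have ba : b != a by rewrite eq_sym.
by case: (linked_cyc (x := x) ba bk ak) => //; rewrite cyc3C // -cyc3V; apply: fixV.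
Qed.

(** If (i j a) and (j k e) fix x, then so does the conjugate of the first by
    the second, which contains i and k as long as e is not i; the remaining
    coincidences are 3-cycles that already contain i and k. *)
Lemma linked_trans x j i k : linked x i j -> linked x j k -> linked x i k.
Proof.
have [->//|ij] := eqVneq i j; have [->//|jk] := eqVneq j k.
have [->|ik] := eqVneq i k; first by rewrite linked_refl.
have ji : j != i by rewrite eq_sym.
have kj : k != j by rewrite eq_sym.
have ki : k != i by rewrite eq_sym.
case/(linkedP _ ij) => a [ai aj xa] /(linkedP _ jk) [e [ej ek xe]].
have ia : i != a by rewrite eq_sym.
have ja : j != a by rewrite eq_sym.
have je : j != e by rewrite eq_sym.
have ke : k != e by rewrite eq_sym.
have [ak|ka] := eqVneq k a; first by subst a; case: (linked_cyc ij ik jk xa).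
have [ei|ie] := eqVneq e i.
  by subst e; case: (linked_cyc jk ji ki xe) => _; rewrite linked_sym.
have := fixJ x (cyc3 i j a) (cyc3 j k e); rewrite xe xa eqxx cyc3J.
rewrite [cyc3 j k e i]cyc3D // 1?eq_sym // cyc3_1 // => /eqP/esym xc.
have ib : i != cyc3 j k e a.
  rewrite -[X in X != _](@cyc3D _ j k e) // 1?eq_sym //.
  by rewrite (inj_eq perm_inj).
have kb : k != cyc3 j k e a.
  rewrite -[X in X != _](@cyc3_1 _ j k e) //.
  by rewrite (inj_eq perm_inj).
by case: (linked_cyc ik ib kb xc).
Qed.

Lemma linked_ra x s i j : linked (ra x s) (s i) (s j) = linked x i j.
Proof.
have h y t a b : linked y a b -> linked (ra y t) (t a) (t b).
  have [->|ab] := eqVneq a b; first by rewrite !linked_refl.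
  case/(linkedP _ ab) => k [ka kb yk].
  have tab : t a != t b by rewrite (inj_eq (@perm_inj _ t)).
  apply/(linkedP _ tab).
  exists (t k); rewrite !(inj_eq (@perm_inj _ t)); split=> //; rewrite -cyc3J.
  by apply/eqP; rewrite fixJ yk.
apply/idP/idP; last exact: h.
by move=> /(h _ s^-1); rewrite raK !permK.
Qed.

(** If (i j a) fixes x and a is linked to k by a 3-cycle (a k b), conjugating
    the former by the latter replaces a with k; when b is i or j, the
    conjugate by the inverse is (k j i) or (i k j). *)
Lemma linked_cyc3 x i j k : i != j -> i != k -> j != k ->
  linked x i j -> linked x j k -> ra x (cyc3 i j k) = x.
Proof.
move=> ij ik jk lij ljk; have /(linkedP _ ij)[a [ai aj xa]] := lij.
have [<-//|ak] := eqVneq a k.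
have ja : j != a by rewrite eq_sym.
have ia : i != a by rewrite eq_sym.
have [_ lja _] := linked_cyc ij ia ja xa.
have : linked x a k by apply: linked_trans ljk; rewrite linked_sym.
case/(linkedP _ ak) => b [ba bk xb].
have ka : k != a by rewrite eq_sym.
have kj : k != j by rewrite eq_sym.
have ki : k != i by rewrite eq_sym.
have := fixJ x (cyc3 i j a) (cyc3 a k b); rewrite xb xa eqxx cyc3J.
have := fixJ x (cyc3 i j a) (cyc3 a b k); rewrite -cyc3V (fixV xb) xa eqxx.
rewrite cyc3V cyc3J => /eqP x2 /eqP x1.
have [bi|ib] := eqVneq b i.
  subst b; move: x2; rewrite cyc3_2 cyc3_1 // [cyc3 a i k j]cyc3D // => x2.
  by rewrite -cyc3V; apply: fixV; rewrite cyc3C.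
have [bj|jb] := eqVneq b j.
  subst b; move: x2; rewrite cyc3_2 cyc3_1 // [cyc3 a j k i]cyc3D // => x2.
  by rewrite -cyc3V; apply: fixV.
move: x1; rewrite cyc3_1 // [cyc3 a k b i]cyc3D // [cyc3 a k b j]cyc3D //.
Qed.

Definition block x i : {set T} := [set j | linked x i j].

(** At most one class contains more than half of T; this is the complement of
    that class, or the whole of T if there is no such class.  Being
    equivariant, it is an invariant that tells points of an orbit apart. *)
Definition minority x : {set T} := [set i | #|block x i| * 2 <= #|T|].

Lemma block_ra x s i : block (ra x s) (s i) = s @: block x i.
Proof.
apply/setP=> j; rewrite -[j](permKV s) mem_imset; last exact: perm_inj.
by rewrite !inE linked_ra.
Qed.

Lemma minority_ra x s : minority (ra x s) = s @: minority x.
Proof.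
apply/setP=> j; rewrite -[j](permKV s) mem_imset; last exact: perm_inj.
by rewrite !inE block_ra card_imset //; exact: perm_inj.
Qed.

Lemma linked_majority x i j :
  i \notin minority x -> j \notin minority x -> linked x i j.
Proof.
rewrite !inE -!ltnNge => bi bj.
have : (block x i :&: block x j) != set0.
  apply/eqP=> bij; have := cardsUI (block x i) (block x j).
  rewrite bij cards0; have := subset_leq_card (subsetT (block x i :|: block x j)).
  by rewrite cardsT; move: bi bj; clear; lia.
case/set0Pn=> k; rewrite !inE => /andP[ik jk].
by apply: linked_trans ik _; rewrite linked_sym.
Qed.

Lemma card_majority x i : i \notin minority x -> #|T| < #|~: minority x| * 2.
Proof.
move=> ix; have: i \notin minority x by []; rewrite inE -ltnNge => /leq_trans; apply.
rewrite leq_mul2r /=; apply/subset_leq_card/subsetP=> j; rewrite !inE => ij.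
move: ix; rewrite !inE; suff -> : block x j = block x i by [].
apply/setP=> k; rewrite !inE; apply/idP/idP => [jk|ik].
  exact: linked_trans ij jk.
by apply: linked_trans ik; rewrite linked_sym.
Qed.

Definition tperm_word (l : seq (T * T)) : {perm T} := \prod_(p <- l) tperm p.1 p.2.

Definition three_swaps x y : Prop := exists2 l, size l <= 3 & y = ra x (tperm_word l).

Lemma card_notin_block x i : minority x = [set: T] -> #|T|./2 <= #|~: block x i|.
Proof.
move=> xT; have : i \in minority x by rewrite xT.
by rewrite inE; have := cardsC (block x i); lia.
Qed.

(** ** Points without a majority class

    The images of x by the 3-cycles (y z o), where y is linked neither to z nor
    to o, are quadratically many: at most 8 of these 3-cycles agree at x. *)
Section NoMajority.
Variables (x : X) (o : T).
Hypothesis small : minority x = [set: T].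

Let free (e : T * T) :=
  [&& ~~ linked x e.1 o, ~~ linked x e.1 e.2 & e.2 != o].
Let img (e : T * T) := ra x (cyc3 e.1 e.2 o).

Let freeN e : free e -> [/\ e.1 != e.2, e.1 != o & e.2 != o].
Proof.
case/and3P=> eo ee e2o; split=> //.
  by apply: contra ee => /eqP->; exact: linked_refl.
by apply: contra eo => /eqP->; exact: linked_refl.
Qed.

(** The quotient of (a b o) and (a b' o) is the 3-cycle (a b b'): if both
    send x to the same point, then a is linked to b. *)
Let img_inj1 e e' : free e -> free e' -> img e = img e' -> e.1 = e'.1 -> e = e'.
Proof.
case: e e' => [a b] [a' b'] fe fe'; rewrite /img /= => + aa; subst a'.
have [/= ab ao bo] := freeN fe; have [/= ab' _ bo'] := freeN fe'.
have [->//|bb'] := eqVneq b b'; move=> /fix_quot xq.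
have qE : cyc3 a b o * (cyc3 a b' o)^-1 = cyc3 a b b'.
  apply/permP=> v; rewrite [LHS]permM cyc3V.
  have [->|va] := eqVneq v a.
    by rewrite !cyc3_1 // 1?eq_sym // cyc3D // eq_sym.
  have [->|vb] := eqVneq v b; first by rewrite !cyc3_2.
  have [->|vb'] := eqVneq v b'.
    by rewrite (@cyc3D _ a b o) // 1?eq_sym // !cyc3_3 // 1?eq_sym.
  have [->|vo] := eqVneq v o.
    rewrite cyc3_3 // 1?eq_sym // cyc3_1 // 1?eq_sym //.
    by rewrite cyc3D // eq_sym.
  by rewrite !cyc3D // eq_sym.
rewrite qE in xq; have [ab_ _ _] := linked_cyc ab ab' bb' xq.
by case/and3P: fe => _; rewrite /= ab_.
Qed.

(** The quotient of (a b o) and (a' b o) is the 3-cycle (a a' o): if both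
    send x to the same point, then a is linked to o. *)
Let img_inj2 e e' : free e -> free e' -> img e = img e' -> e.2 = e'.2 -> e = e'.
Proof.
case: e e' => [a b] [a' b'] fe fe'; rewrite /img /= => + bb; subst b'.
have [/= ab ao bo] := freeN fe; have [/= a'b a'o _] := freeN fe'.
have [->//|aa'] := eqVneq a a'; move=> /fix_quot xq.
have oa : o != a by rewrite eq_sym.
have oa' : o != a' by rewrite eq_sym.
have qE : cyc3 a b o * (cyc3 a' b o)^-1 = cyc3 a a' o.
  apply/permP=> v; rewrite [LHS]permM cyc3V.
  have [->|va] := eqVneq v a.
    by rewrite !cyc3_1 // 1?eq_sym // cyc3_3 // eq_sym.
  have [->|vb] := eqVneq v b.
    by rewrite cyc3_2 cyc3_2 cyc3D // eq_sym.
  have [->|vb'] := eqVneq v a'.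
    by rewrite (@cyc3D _ a b o) // 1?eq_sym // cyc3_1 // 1?eq_sym // cyc3_2.
  have [->|vo] := eqVneq v o.
    by rewrite !cyc3_3 // 1?eq_sym // cyc3D // eq_sym.
  by rewrite !cyc3D // eq_sym.
rewrite qE in xq; have [_ _ ao_] := linked_cyc aa' ao a'o xq.
by case/and3P: fe; rewrite /= ao_.
Qed.

Let meets (e e' : T * T) :=
  [|| e'.1 == e.1, e'.1 == e.2, e'.2 == e.1 | e'.2 == e.2].

Let img_disjoint e1 e2 e3 : free e1 -> free e2 -> free e3 ->
  img e1 = img e2 -> img e1 = img e3 ->
  ~~ meets e1 e2 -> ~~ meets e1 e3 -> ~~ meets e2 e3 -> False.
Proof.
move=> f1 f2 f3 /fix_quot x12 /fix_quot x13.
have [a1 b1 c1] := freeN f1; have [a2 b2 c2] := freeN f2.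
have [a3 b3 c3] := freeN f3.
rewrite /meets !negb_or => /and4P[m1 m2 m3 m4] /and4P[m5 m6 m7 m8].
move=> /and4P[m9 m10 m11 m12].
have := @cyc3_word _ e1.1 e1.2 e2.1 e2.2 e3.1 e3.2 o.
set U := uniq _; have u : U.
  rewrite /U /= !inE !negb_or -!andbA.
  by do ?[apply/andP; split]; rewrite // eq_sym.
move=> /(_ u) /= wE.
have : ra x (cyc3 e3.1 e3.2 o) = x.
  rewrite -wE expgS expg1; have h := fixM (fixM x12 x12) x13; exact: fixM.
case/(linked_cyc a3 b3 c3) => l3 _ _.
by case/and3P: f3 => _; rewrite l3.
Qed.

(** Pairs in a fibre have distinct first and distinct second components, so
    each of them meets at most 4 pairs of the fibre, itself included; among 9
    pairs one finds 3 disjoint ones. *)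
Let fibre_card e : free e -> #|[set e' | free e' && (img e' == img e)]| <= 8.
Proof.
move=> fe; rewrite leqNgt; apply/negP; set B := [set e' | _] => B8.
have inB e' : e' \in B -> free e' /\ img e' = img e.
  by rewrite inE => /andP[? /eqP].
have few e1 : #|[set e' in B | meets e1 e']| <= 4.
  have one (P : pred (T * T)) :
      (forall e' e'', e' \in B -> e'' \in B -> P e' -> P e'' -> e' = e'') ->
      #|[set e' in B | P e']| <= 1.
    move=> h; apply/card_le1_eqP => e' e''; rewrite !inE => /andP[b p] /andP[b' p'].
    by apply: h; rewrite ?inE.
  have one1 a : #|[set e' in B | e'.1 == a]| <= 1.
    apply: one => e' e'' /inB[f' i'] /inB[f'' i''] /eqP a' /eqP a''.
    by apply: img_inj1; rewrite ?i' ?a'.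
  have one2 a : #|[set e' in B | e'.2 == a]| <= 1.
    apply: one => e' e'' /inB[f' i'] /inB[f'' i''] /eqP a' /eqP a''.
    by apply: img_inj2; rewrite ?i' ?a'.
  apply: (@leq_trans #|[set e' in B | e'.1 == e1.1] :|: [set e' in B | e'.1 == e1.2]
    :|: ([set e' in B | e'.2 == e1.1] :|: [set e' in B | e'.2 == e1.2])|).
    apply/subset_leq_card/subsetP=> e'; rewrite !inE /meets => /andP[-> /=].
    by case/or4P => ->; rewrite ?orbT.
  have cU (A C : {set T * T}) : #|A :|: C| <= #|A| + #|C| by rewrite cardsU leq_subr.
  apply: leq_trans (cU _ _) _; apply: (@leq_add _ _ 2 2).
    by apply: leq_trans (cU _ _) _; apply: (@leq_add _ _ 1 1).
  by apply: leq_trans (cU _ _) _; apply: (@leq_add _ _ 1 1).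
have pick e1 (C : {set T * T}) : C \subset B ->
    #|C| <= #|[set e' in C | ~~ meets e1 e']| + 4.
  move=> CB; rewrite -(cardsID [set e' | meets e1 e'] C) addnC leq_add //.
    by apply/subset_leq_card/subsetP => e'; rewrite !inE andbC.
  apply: leq_trans (few e1); apply/subset_leq_card/subsetP => e'.
  by rewrite !inE => /andP[/(subsetP CB)]; rewrite !inE => ->.
pose C := [set e' in B | ~~ meets e e'].
have CB : C \subset B by apply/subsetP=> e'; rewrite inE => /andP[].
have C4 : 4 < #|C| by rewrite -(ltn_add2r 4); apply: leq_trans (pick e B (subxx _)).
have [e2 e2C] : exists e2, e2 \in C by apply/card_gt0P/(leq_trans _ C4).
have : 0 < #|[set e' in C | ~~ meets e2 e']|
  by rewrite -(ltn_add2r 4); apply: leq_trans C4 (pick e2 C CB).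
case/card_gt0P=> e3; rewrite inE => /andP[e3C m23].
have [f2 i2] := inB _ (subsetP CB _ e2C).
have [f3 i3] := inB _ (subsetP CB _ e3C).
move: e2C e3C; rewrite inE => /andP[_ m12]; rewrite inE => /andP[_ m13].
by apply: (img_disjoint fe f2 f3).
Qed.

Lemma no_majority_points : exists s : seq X,
  [/\ uniq s, {in s, forall y, three_swaps x y}
     & #|T|./2 * (#|T|./2).-1 <= 8 * size s].
Proof.
pose A := [set e | free e].
exists (undup [seq img e | e in A]); split; first exact: undup_uniq.
  move=> y; rewrite mem_undup => /imageP[e _ ->].
  by exists [:: (e.1, e.2); (e.1, o)] => //; rewrite /tperm_word !big_cons big_nil mulg1.
apply: (@leq_trans #|A|); last first.
  apply: (@card_le_fibres _ _ img) => e; rewrite inE => fe.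
    by rewrite mem_undup; apply/imageP; exists e; rewrite ?inE.
  apply: leq_trans (fibre_card fe); apply/subset_leq_card/subsetP => e'.
  by rewrite !inE.
have -> : #|A| = \sum_(a | ~~ linked x a o) #|[set b | ~~ linked x a b && (b != o)]|.
  rewrite cardsE -sum1_card.
  under [RHS]eq_bigr do rewrite cardsE -sum1_card.
  rewrite pair_big_dep /=; apply: eq_bigl => -[a b].
  by rewrite /free -!topredE /=.
apply: (@leq_trans (\sum_(a | ~~ linked x a o) (#|T|./2).-1)).
  rewrite sum_nat_const leq_mul2r; apply/orP; right.
  apply: leq_trans (card_notin_block o small) _.
  apply/subset_leq_card/subsetP => a; rewrite !inE linked_sym //.
apply: leq_sum => a ao; have := card_notin_block a small.
have -> : [set b | ~~ linked x a b && (b != o)] = (~: block x a) :\ o.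
  by apply/setP=> b; rewrite !inE andbC.
by rewrite (cardsD1 o (~: block x a)) !inE ao; lia.
Qed.

End NoMajority.

(** ** Points with a majority class that misses two points

    Swapping r1 and r2 with two points of the majority class changes the
    minority set, and the two points can be read off from the new one up to
    order. *)

Section TwoMinority.
Variables (x : X) (r1 r2 : T).
Hypotheses (r1x : r1 \in minority x) (r2x : r2 \in minority x) (r12 : r1 != r2).

Let A : {set T * T} :=
  [set e | [&& e.1 \notin minority x, e.2 \notin minority x & e.1 != e.2]].
Let f (e : T * T) : {perm T} := tperm r1 e.1 * tperm r2 e.2.

Let in_pair e e' : e \in A -> e' \in A -> ra x (f e) = ra x (f e') ->
  e'.1 \in [set e.1; e.2] /\ e'.2 \in [set e.1; e.2].
Proof.
move=> + + /(congr1 minority); rewrite !minority_ra => + + DE.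
case: e e' DE => [a b] [a' b'] DE; rewrite ![_ \in A]inE !in_set2 /=.
move=> /and3P[ax bx ab] /and3P[ax' bx' ab'].
have {}DE : f (a, b) @: minority x = f (a', b') @: minority x := DE.
have ne c d : c \in minority x -> d \notin minority x -> c != d.
  by move=> cx; apply: contra => /eqP<-.
have out c : c \notin minority x -> c \in f (a, b) @: minority x -> (c == a) || (c == b).
  move=> cx /imsetP[d dx cE]; apply: contraT; rewrite negb_or => /andP[ca cb].
  suff E : f (a, b) c = c by move: cx; rewrite (perm_inj (etrans E cE)) dx.
  have [ac bc] : a != c /\ b != c by rewrite ![_ == c]eq_sym.
  by rewrite permM !tpermD // ne.
split; apply: out => //; rewrite DE; apply/imsetP.
  exists r1 => //; rewrite permM tpermL tpermD // ?(ne r2) //.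
  by rewrite eq_sym.
by exists r2 => //; rewrite permM (@tpermD _ r1 a' r2) ?tpermL // eq_sym ne.
Qed.

Lemma two_minority_points : exists s : seq X,
  [/\ uniq s, {in s, forall y, three_swaps x y}
     & #|~: minority x| * #|~: minority x|.-1 <= 4 * size s].
Proof.
exists (undup [seq ra x (f e) | e in A]); split; first exact: undup_uniq.
  move=> y; rewrite mem_undup => /imageP[e _ ->].
  by exists [:: (r1, e.1); (r2, e.2)] => //; rewrite /tperm_word !big_cons big_nil mulg1.
apply: (@leq_trans #|A|); last first.
  apply: (@card_le_fibres _ _ (fun e => ra x (f e))) => e eA.
    by rewrite mem_undup; apply/imageP; exists e.
  apply: (@leq_trans #|setX [set e.1; e.2] [set e.1; e.2]|); last first.
    by rewrite cardsX (@leq_mul _ _ 2 2) // cards2; case: (_ != _).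
  apply/subset_leq_card/subsetP => e'; rewrite inE => /andP[e'A /eqP/esym E].
  by have [h1 h2] := in_pair eA e'A E; rewrite inE h1 h2.
have -> : #|A| = \sum_(a in ~: minority x) #|(~: minority x) :\ a|.
  rewrite -sum1_card; under [RHS]eq_bigr do rewrite -sum1_card.
  rewrite pair_big_dep /=; apply: eq_bigl => -[a b].
  rewrite [_ \in A]inE !in_setD1 !in_setC /= (eq_sym a).
  by case: (a \notin _); case: (b \notin _); rewrite ?andbT ?andbF.
apply: (@leq_trans (\sum_(a in ~: minority x) #|~: minority x|.-1)).
  by rewrite sum_nat_const.
apply: leq_sum => a aM; rewrite (cardsD1 a (~: minority x)) aM; exact: leqnn.
Qed.

End TwoMinority.
End Partition.

(** ** Many images of many moved points *)

Section ManyPoints.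
Variables (n : nat) (X : choiceType).
Let T : finType := 'I_(12 * n).+1.
Variable ra : X -> {perm T} -> X.
Hypothesis n_gt0 : 0 < n.
Hypothesis ra1 : forall x, ra x 1 = x.
Hypothesis raM : forall x s t, ra x (s * t) = ra (ra x s) t.

Let pt k : T := inord k.

Let pt_eq k l : k <= 12 * n -> l <= 12 * n -> (pt k == pt l) = (k == l).
Proof. by move=> kn ln; rewrite -val_eqE /= !inordK. Qed.

(** The transpositions are disjoint for k > 0 and trivial for k = 0.  The triples
    3k, 3k + 1, 3k + 2 do not overlap, so k can be recovered from the image of
    any of 0, 1, 2. *)
Let jump k : {perm T} :=
  tperm_word [:: (pt 0, pt (3 * k)); (pt 1, pt (3 * k).+1); (pt 2, pt (3 * k).+2)].

Let jumpE k e : k < 4 * n -> e < 3 -> jump k (pt e) = pt (3 * k + e).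
Proof.
move=> kn e3; rewrite /jump /tperm_word !big_cons big_nil mulg1 !permM /=.
have pD a b c : a <= 12 * n -> b <= 12 * n -> c <= 12 * n -> a != c -> b != c ->
    tperm (pt a) (pt b) (pt c) = pt c.
  by move=> an bn cn ac bc; rewrite tpermD // pt_eq.
case: k kn => [|k] kn; first by rewrite !muln0 !tperm1 !perm1.
case: e e3 => [|[|[|//]]] _.
- by rewrite tpermL !pD ?addn0 //; lia.
- by rewrite (@pD 0) ?tpermL ?pD ?addn1 //; lia.
- have -> : tperm (pt 0) (pt (3 * k.+1)) (pt 2) = pt 2 by apply: pD; lia.
  have -> : tperm (pt 1) (pt (3 * k.+1).+1) (pt 2) = pt 2 by apply: pD; lia.
  by rewrite tpermL addn2.
Qed.

Let moved (z : X) : Prop := ra z (cyc3 (pt 0) (pt 1) (pt 2)) <> z.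

Let moved_minority z : moved z -> exists2 e, e < 3 & pt e \in minority ra z.
Proof.
move=> mz; have [|m0] := boolP (pt 0 \in minority ra z); first by exists 0.
have [|m1] := boolP (pt 1 \in minority ra z); first by exists 1%N.
have [|m2] := boolP (pt 2 \in minority ra z); first by exists 2.
case: mz; have l12 := linked_majority ra1 raM m1 m2.
have l01 := linked_majority ra1 raM m0 m1.
by apply: (linked_cyc3 ra1 raM _ _ _ l01 l12); rewrite pt_eq; lia.
Qed.

(** If some point of Z has no majority class, or has a majority class that
    misses at least two points, its own orbit already contains n^2 points.
    Otherwise the minority set of each point of Z is a singleton, contained in
    {0, 1, 2} because the 3-cycle (0 1 2) moves the point, and jump k carries
    it to the k-th triple of positions: k, and then the point of Z, are
    recovered from the image.  The factor 12 makes the first two counts, about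
    (6n)^2 / 8 and (6n)^2 / 4, larger than n^2 for all n > 0, and leaves room
    for 4n triples. *)
Lemma many_points (Z : seq X) : uniq Z -> n <= size Z -> {in Z, forall z, moved z} ->
  exists s : seq X, [/\ uniq s, n ^ 2 <= size s
    & {in s, forall y, exists2 z, z \in Z & three_swaps ra z y}].
Proof.
move=> uZ nZ mZ.
have cT : #|T| = (12 * n).+1 by rewrite card_ord.
have in_Z z s : z \in Z -> {in s, forall y, three_swaps ra z y} ->
  {in s, forall y, exists2 z, z \in Z & three_swaps ra z y}.
  by move=> zZ zs y /zs; exists z.
have [/hasP[z zZ /eqP zT]|/hasPn noT] := boolP (has (fun z => minority ra z == setT) Z).
  have [s [us sz cs]] := no_majority_points ra1 raM (pt 0) zT.
  exists s; split=> //; last exact: in_Z zZ sz.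
  move: cs; rewrite cT; nia.
have [/hasP[z zZ z2]|/hasPn no2] := boolP (has (fun z => 1 < #|minority ra z|) Z).
  have [r1 [r2 [r1z r2z r12]]] := card_gt1P z2.
  have [s [us sz cs]] := two_minority_points ra1 raM r1z r2z r12.
  exists s; split=> //; last exact: in_Z zZ sz.
  have : minority ra z != setT by apply: noT.
  rewrite -subTset => /subsetPn[i _ iz].
  have := card_majority ra1 raM iz; rewrite cT; move: cs; nia.
have min1 z : z \in Z -> exists2 e, e < 3 & minority ra z = [set pt e].
  move=> zZ; have [e e3 ez] := moved_minority (mZ z zZ).
  exists e => //; apply/eqP; rewrite eq_sym eqEcard sub1set ez cards1 /=.
  by rewrite leqNgt no2.
exists [seq ra z (jump k) | z <- Z, k <- iota 0 (4 * n)]; split.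
- apply: allpairs_uniq => //; first exact: iota_uniq.
  have kb z k : (z, k) \in [seq (z, k) | z <- Z, k <- iota 0 (4 * n)] ->
      z \in Z /\ k < 4 * n.
    by case/allpairsP=> -[z' k'] /= [zZ + [-> ->]]; rewrite mem_iota.
  move=> [z k] [z' k'] /kb[zZ kn] /kb[z'Z k'n] /= E.
  have := congr1 (minority ra) E; rewrite !(minority_ra ra1 raM).
  have [e e3 ->] := min1 _ zZ; have [e' e'3 ->] := min1 _ z'Z.
  rewrite !imset_set1 !jumpE // => /set1_inj/eqP.
  have [le le'] : 3 * k + e <= 12 * n /\ 3 * k' + e' <= 12 * n by lia.
  rewrite pt_eq // => kk; have kk' : k = k' by lia.
  move: E; rewrite -kk' => E; congr (_, _); move/(congr1 (fun y => ra y (jump k)^-1)): E.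
  by rewrite !(raK ra1 raM).
- by rewrite size_allpairs size_iota -mulnn leq_mul //; lia.
- move=> y /allpairsP[[z k] /= [zZ _ ->]]; exists z => //.
  by eexists; last reflexivity.
Qed.

End ManyPoints.

(** * Balls in finitely generated groups *)

Section Balls.
Variables (L : groupType) (S : seq L).
Hypothesis SV : forall s, s \in S -> s^-1 \in S.

Lemma ball_one n : ball S n 1.
Proof. by exists [::]; rewrite ?big_nil //; split=> // x; rewrite in_nil. Qed.

Lemma ball_mul m n g h : ball S m g -> ball S n h -> ball S (m + n) (g * h).
Proof.
case=> v [vm vS] <- [w [wn wS] <-]; exists (v ++ w); last by rewrite big_cat.
split; first by rewrite size_cat leq_add.
by move=> x; rewrite mem_cat => /orP[/vS|/wS].
Qed.

Lemma ball_mono m n g : m <= n -> ball S m g -> ball S n g.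
Proof. by move=> mn [w [wm wS] <-]; exists w => //; split=> //; exact: leq_trans mn. Qed.

Lemma ball_inv n g : ball S n g -> ball S n g^-1.
Proof.
case=> w [wn wS] <-; exists (rev [seq x^-1 | x <- w]).
  split; first by rewrite size_rev size_map.
  move=> x; rewrite mem_rev => /mapP[y /wS yS ->]; exact: SV.
elim: w {wn wS} => [|x w IH]; first by rewrite !big_nil invg1.
by rewrite /= rev_cons -cats1 big_cat IH big_seq1 big_cons invgM.
Qed.

Lemma ball_exp m n g : ball S m g -> ball S (m * n) (g ^+ n).
Proof.
move=> gm; elim: n => [|n IH]; first by rewrite muln0 expg0; exact: ball_one.
by rewrite mulnS expgS; exact: ball_mul.
Qed.

Lemma ball_conj m n g h : ball S m g -> ball S n h -> ball S (m + n + m) (g * h * g^-1).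
Proof. by move=> gm hn; apply: ball_mul (ball_inv gm); exact: ball_mul. Qed.

End Balls.

(** Generation by S is expressed through predicates closed under the group
    operations, which spares the explicit words. *)
Lemma finitely_generated_by (L : groupType) (S : seq L) :
  (forall Gen : L -> Prop, Gen 1 -> (forall g h, Gen g -> Gen h -> Gen (g * h)) ->
    (forall g, Gen g -> Gen g^-1) -> {in S, forall g, Gen g} -> forall g, Gen g) ->
  finitely_generated L.
Proof.
move=> gen; pose S' := S ++ [seq x^-1 | x <- S]; exists S'.
have SV s : s \in S' -> s^-1 \in S'.
  rewrite !mem_cat => /orP[sS|/mapP[x xS ->]]; last by rewrite invgK xS.
  by rewrite map_f ?orbT.
split=> //; apply: gen => [|g h [m gm] [n hn]|g [n gn]|g gS].
- by exists 0%N; exact: ball_one.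
- by exists (m + n); exact: ball_mul.
- by exists n; exact: ball_inv.
- exists 1%N, [:: g]; last by rewrite big_seq1.
  by split=> // x; rewrite inE => /eqP->; rewrite mem_cat gS.
Qed.

Section Morphism.
Variables (G L : groupType) (phi : G -> L).
Hypothesis phiM : forall g h, phi (g * h) = phi g * phi h.

Lemma morph_one : phi 1 = 1.
Proof. by apply: (mulgI (phi 1)); rewrite -phiM !mulg1. Qed.

Lemma morph_inv g : phi g^-1 = (phi g)^-1.
Proof. by apply: (mulgI (phi g)); rewrite -phiM !mulgV morph_one. Qed.

End Morphism.

(** * Shifts, transpositions and finite permutations in Houghton groups *)

Section HoughtonElements.
Variable r : nat.
Implicit Types (i j : 'I_r) (u v : xi_vertex r) (g h : houghton r).

Lemma ray_pt_inj i j m n : ray_pt i m.+1 = ray_pt j n -> i = j /\ m.+1 = n.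
Proof. by case: n => [//|n] [-> ->]. Qed.

Definition depth v : nat := if v is Some (_, k) then k.+1 else 0.

Lemma depth_ray i k : depth (ray_pt i k) = k.
Proof. by case: k. Qed.

(** The successors put the origin, which is common to all rays, into both
    exceptional sets, so that the conditions on different rays do not
    interact. *)
Lemma houghton_perm_transl (g g' : xi_vertex r -> xi_vertex r) :
  cancel g g' -> cancel g' g ->
  (forall i, exists a b, forall k, g (ray_pt i (a.+1 + k)) = ray_pt i (b.+1 + k)) ->
  houghton_perm g.
Proof.
move=> gK g'K /choice[a] /choice[b] gab.
have fin (c : 'I_r -> nat) :
    finite_set [set v | exists i k, v = ray_pt i k /\ k <= c i]%classic.
  apply: (@sub_finite_set _ _
    [set` [seq ray_pt i k | i <- enum 'I_r, k <- iota 0 (c i).+1]]%classic).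
    move=> v [i [k [-> kc]]]; apply/allpairsPdep; exists i, k.
    by rewrite mem_enum mem_iota.
  exact: finite_seq.
split; first by exists g'.
exists [set v | exists i k, v = ray_pt i k /\ k <= a i]%classic.
exists [set v | exists i k, v = ray_pt i k /\ k <= b i]%classic; split=> // i.
have out (c : 'I_r -> nat) u : (ray i `\` [set v | exists i k, v = ray_pt i k /\ k <= c i])%classic u <->
    exists k, u = ray_pt i ((c i).+1 + k).
  split=> [[[m _ <-] nE]|[k ->]].
    exists (m - (c i).+1); rewrite subnKC // ltnNge; apply/negP => mc.
    by apply: nE; exists i, m.
  split; first by eexists.
  by case=> j [m [E]]; have [<- <-] := @ray_pt_inj i j (c i + k) m E; lia.
split.
  apply/seteqP; split=> [_ [u /out[k ->] <-]|v /out[k ->]].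
    by rewrite gab; apply/out; exists k.
  by exists (ray_pt i ((a i).+1 + k)); rewrite ?gab //; apply/out; exists k.
move=> u v /out[k ->] /out[l ->]; rewrite !gab !xi_dist_same; lia.
Qed.

(** An isometry between cofinite parts of a ray preserves the direction: seen
    from the image m0 of the first point c, points at distance larger than m0
    can only lie further out. *)
Lemma houghton_transl g i :
  exists a b, forall k, g (ray_pt i (a.+1 + k)) = ray_pt i (b.+1 + k).
Proof.
have [_ [E [F [fE _ gEF]]]] := houghtonP g; have [gi gd] := gEF i.
have [c cE] : exists c, forall k, c <= k -> ~ E (ray_pt i k).
  have [s sE] : exists s : seq (xi_vertex r), E = [set` s]%classic.
    exact/finite_seqP.
  exists (\max_(v <- s) depth v).+1 => k ck; rewrite sE /= => kE.
  have := @leq_bigmax_seq _ s xpredT depth _ kE isT.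
  by rewrite depth_ray leqNgt ck.
have gray k : c <= k -> exists m, g (ray_pt i k) = ray_pt i m.
  move=> ck; have : (g @` (ray i `\` E))%classic (g (ray_pt i k)).
    by exists (ray_pt i k) => //; split; [exists k | exact: cE].
  by rewrite gi => -[[m _ <-] _]; exists m.
have [m0 gm0] := gray c (leqnn c).
exists (c + m0), (m0 + m0) => k.
have [m gm] := gray ((c + m0).+1 + k) ltac:(lia).
have out l : c <= l -> (ray i `\` E)%classic (ray_pt i l).
  by move=> cl; split; [exists l | exact: cE].
have := gd _ _ (out _ (leqnn c)) (out ((c + m0).+1 + k) ltac:(lia)).
rewrite gm0 gm !xi_dist_same => ?; congr ray_pt; lia.
Qed.

Lemma houghton_perm_finitary K (g g' : xi_vertex r -> xi_vertex r) :
  cancel g g' -> cancel g' g -> (forall v, K < depth v -> g v = v) ->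
  houghton_perm g.
Proof.
move=> gK g'K gid; apply: (houghton_perm_transl gK g'K) => i; exists K, K => k.
by rewrite gid // depth_ray; lia.
Qed.

Definition swap_fun u v x := if x == u then v else if x == v then u else x.

Lemma swap_funK u v : involutive (swap_fun u v).
Proof.
move=> x; rewrite /swap_fun; have [->|xu] := eqVneq x u.
  by rewrite eqxx; have [->|] := eqVneq v u.
have [->|xv] := eqVneq x v; first by rewrite eqxx.
by rewrite (negPf xu) (negPf xv).
Qed.

Lemma houghton_swap u v : houghton_perm (swap_fun u v).
Proof.
apply: (@houghton_perm_finitary (maxn (depth u) (depth v)) _ _ (swap_funK u v) (swap_funK u v)).
move=> x; rewrite gtn_max /swap_fun => /andP[ux vx].
have [xu|_] := eqVneq x u; first by rewrite xu ltnn in ux.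
by have [xv|//] := eqVneq x v; rewrite xv ltnn in vx.
Qed.

Definition hswap u v : houghton r := Houghton (asboolT (houghton_swap u v)).

Lemma houghton_eq g h : (forall x, g x = h x) -> g = h.
Proof. by move=> gh; apply/val_inj/funext. Qed.

Lemma houghton_inj g : injective g.
Proof. exact: can_inj (houghton_invK g). Qed.

Lemma houghton_mulE g h x : (g * h) x = g (h x). Proof. by []. Qed.
Lemma houghton_VK g x : g^-1 (g x) = x. Proof. exact: houghton_invK. Qed.
Lemma houghton_KV g x : g (g^-1 x) = x. Proof. exact: houghton_invrK. Qed.

Lemma hswapJ g u v : g * hswap u v * g^-1 = hswap (g u) (g v).
Proof.
apply: houghton_eq => x; have gE w : (g^-1 x == w) = (x == g w).
  by rewrite -(inj_eq (@houghton_inj g)) houghton_KV.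
rewrite !houghton_mulE; change (g (swap_fun u v (g^-1 x)) = swap_fun (g u) (g v) x).
rewrite /swap_fun !gE; do 2![case: ifP => // _]; exact: houghton_KV.
Qed.

Lemma hswapxx u : hswap u u = 1.
Proof. by apply: houghton_eq => x /=; rewrite /swap_fun; case: eqP => [->|]. Qed.

Lemma hswapC u v : hswap u v = hswap v u.
Proof.
apply: houghton_eq => x /=; rewrite /swap_fun.
by have [->|xu] := eqVneq x u; [have [->|] := eqVneq u v | case: ifP].
Qed.

(** Translation by one of the line formed by the rays i and j, from j to i. *)
Definition shift_fun i j v : xi_vertex r :=
  match v with
  | None => Some (i, 0)
  | Some (l, k) =>
      if l == i then Some (i, k.+1)
      else if l == j then ray_pt j k else Some (l, k)
  end.

Lemma shift_funK i j : i != j -> cancel (shift_fun i j) (shift_fun j i).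
Proof.
move=> ij [[l k]|] /=; last by rewrite (negPf ij) eqxx.
have [->|li] := eqVneq l i; first by rewrite /= (negPf ij) eqxx.
have [->|lj] := eqVneq l j; first by case: k => //= k; rewrite eqxx.
by rewrite /= (negPf li) (negPf lj).
Qed.

Lemma houghton_shift i j (ij : i != j) : houghton_perm (shift_fun i j).
Proof.
have ji : j != i by rewrite eq_sym.
apply: (houghton_perm_transl (shift_funK ij) (shift_funK ji)) => l.
have [->|li] := eqVneq l i; first by exists 0%N, 1%N => k /=; rewrite eqxx.
have [->|lj] := eqVneq l j.
  by exists 1%N, 0%N => k /=; rewrite (negPf ji) eqxx.
by exists 0%N, 0%N => k /=; rewrite (negPf li) (negPf lj).
Qed.

Definition hshift i j (ij : i != j) : houghton r :=
  Houghton (asboolT (houghton_shift ij)).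

Lemma hshift_src i j (ij : i != j) k : hshift ij (ray_pt i k) = ray_pt i k.+1.
Proof. by case: k => //= k; rewrite eqxx. Qed.

Lemma hshift_dst i j (ij : i != j) k : hshift ij (ray_pt j k.+1) = ray_pt j k.
Proof. by rewrite /= eq_sym (negPf ij) eqxx. Qed.

Lemma hshift_other i j (ij : i != j) l k : l != i -> l != j ->
  hshift ij (ray_pt l k.+1) = ray_pt l k.+1.
Proof. by move=> /negPf li /negPf lj; rewrite /= li lj. Qed.

Lemma hshiftX_src i j (ij : i != j) n k :
  (hshift ij ^+ n) (ray_pt i k) = ray_pt i (n + k).
Proof.
elim: n => [|n IH]; first by rewrite expg0.
by rewrite expgS houghton_mulE IH hshift_src.
Qed.

Lemma hshiftX_dst i j (ij : i != j) n k :
  (hshift ij ^+ n) (ray_pt j (n + k)) = ray_pt j k.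
Proof.
elim: n => [|n IH]; first by rewrite expg0.
by rewrite expgSr houghton_mulE addSn hshift_dst IH.
Qed.

Lemma hshiftX_other i j (ij : i != j) l n k : l != i -> l != j ->
  (hshift ij ^+ n) (ray_pt l k.+1) = ray_pt l k.+1.
Proof.
move=> li lj; elim: n => [|n IH]; first by rewrite expg0.
by rewrite expgS houghton_mulE IH hshift_other.
Qed.

Section SwapLength.
Variables (L : groupType) (phi : houghton r -> L) (S : seq L).
Hypothesis phiM : forall g h, phi (g * h) = phi g * phi h.
Hypothesis Ssym : symmetric_generating S.
Variables (i j : 'I_r).
Hypothesis ij : i != j.

Let p k := ray_pt i k.

(** The word w sends the vertices 0 and a.+1 to 0 and a.+2, so a transposition
    of 0 with a vertex at distance a is a conjugate by the power w^a and has
    word length linear in a. *)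
Lemma star_rec a :
  let w := hswap (p 0) (p 1) * hshift ij in
  hswap (p 0) (p a.+2) = w * hswap (p 0) (p a.+1) * w^-1.
Proof.
move=> w; rewrite /w /p hswapJ !houghton_mulE !hshift_src /=.
congr hswap; rewrite /swap_fun ?eqxx; first by case: eqP.
by case: eqP => // _; case: eqP => // -[].
Qed.

(** The translation carries the vertices 0 and b - a to a and b. *)
Lemma ball_swap : exists C, forall q a b, a <= q -> b <= q ->
  ball S (C * q + C) (phi (hswap (p a) (p b))).
Proof.
have [m tm] := Ssym.2 (phi (hshift ij)).
have [n sn] := Ssym.2 (phi (hswap (p 0) (p 1))).
have star a : ball S ((2 * m + 2 * n) * a + n) (phi (hswap (p 0) (p a.+1))).
  elim: a => [|a IH]; first by rewrite muln0.
  rewrite star_rec !phiM (morph_inv phiM) phiM.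
  apply: ball_mono (ball_conj Ssym.1 (ball_mul sn tm) IH); lia.
have lt a b q : a < b -> b <= q ->
    ball S ((4 * m + 2 * n) * q + n) (phi (hswap (p a) (p b))).
  move=> ab bq; have -> : hswap (p a) (p b) =
      hshift ij ^+ a * hswap (p 0) (p (b - a.+1).+1) * (hshift ij ^+ a)^-1.
    by rewrite hswapJ !hshiftX_src addn0; congr (hswap _ (p _)); lia.
  rewrite !phiM (morph_inv phiM); have tX : phi (hshift ij ^+ a) = phi (hshift ij) ^+ a.
    by elim: (a) => [|c IH]; rewrite ?expg0 ?(morph_one phiM) // !expgS phiM IH.
  rewrite tX; apply: ball_mono (ball_conj Ssym.1 (ball_exp a tm) (star _)).
  have : m * a <= m * q by rewrite leq_mul2l; lia.
  have : (2 * m + 2 * n) * (b - a.+1) <= (2 * m + 2 * n) * q by rewrite leq_mul2l; lia.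
  rewrite !mulnDl; lia.
exists (4 * m + 2 * n) => q a b aq bq.
have [ab|ba|ab] := ltngtP a b.
- by apply: ball_mono (lt _ _ _ ab bq); lia.
- by rewrite hswapC; apply: ball_mono (lt _ _ _ ba aq); lia.
- by rewrite ab hswapxx (morph_one phiM); exact: ball_one.
Qed.

End SwapLength.

Section PermEmbedding.
Variables (i : 'I_r) (q : nat).
Let T := 'I_q.+1.

(** Permutations of the first q + 1 vertices of a ray.  As permutations compose
    from left to right and elements of Houghton groups from right to left, this
    is an anti-morphism. *)
Definition emb_fun (s : {perm T}) v : xi_vertex r :=
  if (v == ray_pt i (depth v)) && (depth v <= q)
  then ray_pt i (s (inord (depth v))) else v.

Lemma emb_ray s k : emb_fun s (ray_pt i k) = if k <= q then ray_pt i (s (inord k)) else ray_pt i k.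
Proof. by rewrite /emb_fun depth_ray eqxx. Qed.

Lemma emb_other s v : v != ray_pt i (depth v) -> emb_fun s v = v.
Proof. by rewrite /emb_fun => /negPf->. Qed.

Lemma emb_fun1 v : emb_fun 1 v = v.
Proof.
have [->|] := eqVneq v (ray_pt i (depth v)); last exact: emb_other.
by rewrite emb_ray; case: leqP => // kq; rewrite perm1 inordK.
Qed.

Lemma emb_funM s t v : emb_fun (s * t) v = emb_fun t (emb_fun s v).
Proof.
have [->|vi] := eqVneq v (ray_pt i (depth v)); last by rewrite !emb_other.
rewrite !emb_ray; case: leqP => kq; last by rewrite emb_ray leqNgt kq.
by rewrite emb_ray -ltnS ltn_ord permM inord_val.
Qed.

Lemma houghton_emb s : houghton_perm (emb_fun s).
Proof.
apply: (@houghton_perm_finitary q _ (emb_fun s^-1)) => v.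
- by rewrite -emb_funM mulgV emb_fun1.
- by rewrite -emb_funM mulVg emb_fun1.
- by move=> qv; rewrite /emb_fun leqNgt qv andbF.
Qed.

Definition emb s : houghton r := Houghton (asboolT (houghton_emb s)).

Lemma emb1 : emb 1 = 1.
Proof. by apply: houghton_eq => v; exact: emb_fun1. Qed.

Lemma embM s t : emb (s * t) = emb t * emb s.
Proof. by apply: houghton_eq => v; exact: emb_funM. Qed.

Lemma emb_tperm (a b : T) : emb (tperm a b) = hswap (ray_pt i a) (ray_pt i b).
Proof.
apply: houghton_eq => v /=; rewrite /swap_fun.
have ri k l : (ray_pt i k == ray_pt i l) = (k == l).
  by apply/eqP/eqP => [/(congr1 depth)|->//]; rewrite !depth_ray.
have [->|vi] := eqVneq v (ray_pt i (depth v)); last first.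
  rewrite emb_other //; case: eqP => [va|_].
    by move: vi; rewrite va depth_ray eqxx.
  by case: eqP => // va; move: vi; rewrite va depth_ray eqxx.
move: (depth v) => k; rewrite emb_ray !ri; case: leqP => kq; last first.
  have [-> -> //] : (k == a) = false /\ (k == b) = false.
  by have := ltn_ord a; have := ltn_ord b; lia.
case: tpermP => [ka|kb|/eqP ka /eqP kb].
- by rewrite -ka inordK // eqxx.
- rewrite -kb inordK // eqxx; case: eqP => // ba; congr ray_pt; rewrite ba.
  by [].
- move: ka kb; rewrite -!val_eqE /= inordK // => /negPf-> /negPf->.
  by [].
Qed.

End PermEmbedding.

End HoughtonElements.

(** * Houghton groups are finitely generated *)

Section HoughtonGeneration.
Variables (r : nat) (i0 j0 : 'I_r).
Hypothesis ij0 : i0 != j0.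
Variable Gen : houghton r -> Prop.
Hypothesis Gen1 : Gen 1.
Hypothesis GenM : forall g h, Gen g -> Gen h -> Gen (g * h).
Hypothesis GenV : forall g, Gen g -> Gen g^-1.
Hypothesis Gen_shift : forall j (ij : i0 != j), Gen (hshift ij).
Hypothesis Gen_swap : Gen (hswap (ray_pt i0 0) (ray_pt i0 1)).
Implicit Types (g h : houghton r) (u v : xi_vertex r).

Let GenX g n : Gen g -> Gen (g ^+ n).
Proof. by move=> Gg; elim: n => [|n IH]; rewrite ?expg0 ?expgS //; exact: GenM. Qed.

Let GenJ g h : Gen g -> Gen h -> Gen (g * h * g^-1).
Proof. by move=> Gg Gh; apply: GenM (GenV Gg); exact: GenM. Qed.

(** A power of the shift from the ray of u to the ray i0 moves u to the origin
    and the origin to the ray i0, where the transpositions are conjugates of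
    the given one. *)
Let Gen_star u : Gen (hswap None u).
Proof.
have ray0 a : Gen (hswap None (ray_pt i0 a)).
  case: a => [|a]; first by rewrite hswapxx.
  elim: a => [//|a IH]; rewrite -[None]/(ray_pt i0 0) (star_rec ij0).
  by apply: GenJ IH; apply: GenM Gen_swap (Gen_shift _).
have [j [k ->]] := xi_ray_pt i0 u.
have [<-//|ij] := eqVneq i0 j; pose t := hshift ij ^+ k.
have -> : hswap None (ray_pt j k) = t^-1 * hswap None (ray_pt i0 k) * t^-1^-1.
  have tj : t (ray_pt j k) = None by have := hshiftX_dst ij k 0; rewrite addn0.
  have ti : t None = ray_pt i0 k by have := hshiftX_src ij k 0; rewrite addn0.
  by rewrite hswapJ hswapC -ti houghton_VK -{2}tj houghton_VK.
by apply: GenJ (ray0 k); apply: GenV; apply: GenX.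
Qed.

Lemma Gen_hswap u v : Gen (hswap u v).
Proof.
have [->|uv] := eqVneq u v; first by rewrite hswapxx.
have [->|u0] := eqVneq u None; first exact: Gen_star.
have [->|v0] := eqVneq v None; first by rewrite hswapC; exact: Gen_star.
have -> : hswap u v = hswap None u * hswap None v * (hswap None u)^-1.
  by rewrite hswapJ /= /swap_fun eqxx (negPf v0) eq_sym (negPf uv).
exact: GenJ.
Qed.

(** Composing g with the transposition of a and g a fixes a and creates no new
    moved point. *)
Lemma Gen_finitary (s : seq (xi_vertex r)) g :
  (forall v, v \notin s -> g v = v) -> Gen g.
Proof.
elim: s g => [|a s IH] g gs.
  by have -> : g = 1 by apply: houghton_eq => v; rewrite gs.
have -> : g = hswap a (g a) * (hswap a (g a) * g).
  by apply: houghton_eq => v; rewrite !houghton_mulE /= swap_funK.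
apply: GenM (Gen_hswap _ _) _; apply: IH => v vs.
rewrite houghton_mulE /= /swap_fun; have [->|va] := eqVneq v a.
  by rewrite eqxx; case: eqP.
have gv : g v = v by apply: gs; rewrite inE negb_or va.
by rewrite gv (negPf va); case: eqP => // vga; move: va; rewrite -(inj_eq (@houghton_inj _ g)) gv vga eqxx.
Qed.

Definition straight i g : Prop :=
  exists K, forall k, K <= k -> g (ray_pt i k.+1) = ray_pt i k.+1.

(** If g sends the vertex a + 1 + k of the ray j to b + 1 + k, then composing
    with powers of the shift along j on both sides makes g the identity far out
    on j. *)
Lemma straighten_one j g : i0 != j -> exists g1 g2, [/\ Gen g1, Gen g2,
  straight j (g1 * g * g2) &
  forall l, l != i0 -> l != j -> straight l g -> straight l (g1 * g * g2)].
Proof.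
move=> ij; have [a [b gab]] := houghton_transl g j.
exists (hshift ij ^+ b.+1), (hshift ij ^+ a.+1)^-1; split.
- by apply: GenX.
- by apply: GenV; apply: GenX.
- exists 0%N => k _; rewrite !houghton_mulE -{1}(hshiftX_dst ij a.+1 k.+1).
  by rewrite houghton_VK gab hshiftX_dst.
- move=> l li lj [K gK]; exists K => k Kk.
  rewrite !houghton_mulE -{1}(hshiftX_other ij a.+1 k li lj) houghton_VK gK //.
  exact: hshiftX_other.
Qed.

Lemma straighten (s : seq 'I_r) g : i0 \notin s -> exists g1 g2,
  [/\ Gen g1, Gen g2 & {in s, forall l, straight l (g1 * g * g2)}].
Proof.
elim: s => [|j s IH]; first by exists 1, 1; split.
rewrite inE negb_or => /andP[ij /[dup] i0s /IH [g1 [g2 [G1 G2 st]]]].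
have [h1 [h2 [H1 H2 sj so]]] := straighten_one (g1 * g * g2) ij.
exists (h1 * g1), (g2 * h2); split; try exact: GenM.
have -> : h1 * g1 * g * (g2 * h2) = h1 * (g1 * g * g2) * h2 by rewrite !mulgA.
move=> l; rewrite inE; have [->//|lj /= ls] := eqVneq l j.
by apply: so => //; [apply: contraNneq i0s => <- | exact: st].
Qed.

(** On the only ray where g is not yet known to be trivial far out, g shifts by
    b - a; it maps the finite set V a of remaining vertices bijectively onto
    V b, and counting gives a = b. *)
Lemma straight_last g :
  (forall l, l != i0 -> straight l g) ->
  exists K, forall v, K < depth v -> g v = v.
Proof.
move=> st; have [K gK] : exists K, forall l k, l != i0 -> K <= k ->
    g (ray_pt l k.+1) = ray_pt l k.+1.
  have /choice[K gK] : forall l, exists K, l != i0 -> forall k, K <= k ->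
      g (ray_pt l k.+1) = ray_pt l k.+1.
    move=> l; have [->|/st[K gK]] := eqVneq l i0; first by exists 0%N.
    by exists K.
  exists (\max_l K l) => l k li Kk; apply: gK => //; apply: leq_trans Kk.
  exact: leq_bigmax.
have [a [b gab]] := houghton_transl g i0.
pose V c : seq (xi_vertex r) := None :: [seq Some (i0, k) | k <- iota 0 c]
  ++ [seq Some (l, k) | l <- [seq l <- enum 'I_r | l != i0], k <- iota 0 K].
have memV c v : (v \in V c) =
    if v is Some (l, k) then if l == i0 then k < c else k < K else true.
  rewrite inE mem_cat; case: v => [[l k]|//] /=; apply/orP/idP.
    case=> [/mapP[m + [-> ->]]|/allpairsP[[l' m] /= [+ + [-> ->]]]].
      by rewrite mem_iota eqxx.
    by rewrite mem_filter mem_iota => /andP[/negPf-> _].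
  have [->|li] := eqVneq l i0 => kc; [left|right].
    by apply/mapP; exists k; rewrite ?mem_iota.
  by apply/allpairsP; exists (l, k); rewrite mem_filter li mem_enum mem_iota.
have VP c v : v \notin V c <-> (exists k, v = ray_pt i0 (c.+1 + k)) \/
    (exists l k, [/\ l != i0, K <= k & v = ray_pt l k.+1]).
  rewrite memV; split.
    case: v => [[l k]|//]; have [->|li] := eqVneq l i0; rewrite -leqNgt => ck.
      by left; exists (k - c); rewrite addSn subnKC.
    by right; exists l, k.
  case=> [[k ->]|[l [k [li Kk ->]]]] /=; first by rewrite eqxx -leqNgt leq_addr.
  by rewrite (negPf li) -leqNgt.
have uV c : uniq (V c).
  rewrite /V cons_uniq cat_uniq; apply/and4P; split.
  - rewrite mem_cat negb_or; apply/andP; split; first by apply/negP => /mapP[].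
    by apply/negP => /allpairsP[[? ?] []].
  - by rewrite map_inj_uniq ?iota_uniq // => ? ? [].
  - apply/hasPn => _ /allpairsP[[l k] /= [+ _ ->]]; rewrite mem_filter => /andP[li _].
    by apply/mapP => -[m _ [lE]]; rewrite lE eqxx in li.
  - apply: allpairs_uniq; [exact/filter_uniq/enum_uniq | exact: iota_uniq |].
    by move=> [? ?] [? ?] _ _ [-> ->].
have sV c : size (V c) = c.+1 + size [seq Some (l, k) | l <- [seq l <- enum 'I_r | l != i0], k <- iota 0 K].
  by rewrite /= size_cat size_map size_iota.
have gV v : (g v \notin V b) = (v \notin V a).
  apply/idP/idP => [/VP[[k gv]|[l [k [li Kk gv]]]]|/VP[[k ->]|[l [k [li Kk ->]]]]].
  - apply/VP; left; exists k; apply: (@houghton_inj _ g); by rewrite gab.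
  - apply/VP; right; exists l, k; split=> //; apply: (@houghton_inj _ g).
    by rewrite gK.
  - by apply/VP; left; exists k; rewrite gab.
  - by apply/VP; right; exists l, k; rewrite gK.
have : perm_eq [seq g v | v <- V a] (V b).
  apply: uniq_perm => //; first by rewrite map_inj_uniq //; exact: houghton_inj.
  move=> v; rewrite -[v](houghton_KV g) mem_map; last exact: houghton_inj.
  by apply: negb_inj; rewrite gV.
move/perm_size; rewrite size_map !sV => /eqP; rewrite eqn_add2r eqSS => /eqP ab.
subst b.
exists (maxn a.+1 K) => v; have [l [k ->]] := xi_ray_pt i0 v.
rewrite depth_ray gtn_max => /andP[ak Kk].
have [->|li] := eqVneq l i0; first by rewrite -(subnKC (ltnW ak)) gab.
by case: k Kk ak => // k Kk _; apply: gK.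
Qed.

(** Straightening g on all rays but i0 makes it finitary, by straight_last, and
    finitary elements are products of transpositions. *)
Lemma Gen_all g : Gen g.
Proof.
have [|g1 [g2 [G1 G2 st]]] := @straighten [seq l <- enum 'I_r | l != i0] g.
  by rewrite mem_filter eqxx.
have [|K gK] := @straight_last (g1 * g * g2).
  by move=> l li; apply: st; rewrite mem_filter li mem_enum.
have -> : g = g1^-1 * (g1 * g * g2) * g2^-1 by rewrite !mulgA mulVg mul1g mulgK.
apply: GenM (GenV G2); apply: GenM (GenV G1) _.
apply: (@Gen_finitary [seq ray_pt l k | l <- enum 'I_r, k <- iota 0 K.+1]) => v vK.
apply: gK; rewrite ltnNge; apply: contra vK => vK.
have [l [k vE]] := xi_ray_pt i0 v; apply/allpairsP; exists (l, k).
by rewrite mem_enum mem_iota; split=> //; move: vK; rewrite vE depth_ray.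
Qed.

End HoughtonGeneration.

Lemma houghton_fg (r : nat) : 2 <= r -> finitely_generated (houghton r).
Proof.
case: r => [|[|r]] // _; pose i0 : 'I_r.+2 := ord0.
have ij0 : i0 != lift ord0 ord0 by rewrite neq_lift.
pose sh j : houghton r.+2 :=
  if @idP (i0 != j) is ReflectT ij then hshift ij else 1.
apply: (@finitely_generated_by _ (hswap (ray_pt i0 0) (ray_pt i0 1) :: [seq sh j | j <- enum 'I_r.+2])).
move=> Gen G1 GM GV GS.
apply: (Gen_all ij0 G1 GM GV) => [j ij|]; last by apply: GS; rewrite inE eqxx.
have -> : hshift ij = sh j.
  rewrite /sh; case: {-}_ / idP => [ij'|/(_ ij)//].
  by congr hshift; exact: bool_irrelevance.
by apply: GS; rewrite inE map_f ?orbT // mem_enum.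
Qed.

(** * Free products *)

Lemma gset_act1 (L : groupType) X (a : gset L X) x : a 1 x = x.
Proof. by case: a. Qed.

Lemma gset_actM (L : groupType) X (a : gset L X) g h x : a (g * h) x = a g (a h x).
Proof. by case: a. Qed.

Section FreeProductTheory.
Variables G H : groupType.
Local Notation GH := (free_product G H).

Definition fp_inl (g : G) : GH := \pi_(free_product G H) [:: inl g].
Definition fp_inr (h : H) : GH := \pi_(free_product G H) [:: inr h].

Lemma fp_mulgE (u v : seq (G + H)) :
  \pi_GH u * \pi_GH v = \pi_GH (u ++ v).
Proof. exact: fp_mulE. Qed.

Lemma fp_inlD g g' : fp_inl (g * g') = fp_inl g * fp_inl g'.
Proof. rewrite fp_mulgE; apply/esym/fp_piP; exact: fp_inlM. Qed.

Lemma fp_inrD h h' : fp_inr (h * h') = fp_inr h * fp_inr h'.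
Proof. rewrite fp_mulgE; apply/esym/fp_piP; exact: fp_inrM. Qed.

Lemma free_product_fg :
  finitely_generated G -> finitely_generated H -> finitely_generated GH.
Proof.
move=> [SG [symG genG]] [SH [symH genH]].
apply: (@finitely_generated_by _ ([seq fp_inl g | g <- SG] ++ [seq fp_inr h | h <- SH])).
move=> Gen G1 GM GV GS.
have one (x : G + H) : Gen (\pi_GH [:: x]).
  case: x => [g|h].
    have [n [w [_ wS] <-]] := genG g; rewrite -/(fp_inl _).
    elim: w wS => [|s w IH] wS.
      rewrite big_nil; suff -> : fp_inl 1 = 1 by [].
      apply/fp_piP; exact: fp_inl1.
    rewrite big_cons fp_inlD; apply: GM.
      by apply: GS; rewrite mem_cat map_f // wS // mem_head.
    by apply: IH => x xw; apply: wS; rewrite inE xw orbT.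
  have [n [w [_ wS] <-]] := genH h; rewrite -/(fp_inr _).
  elim: w wS => [|s w IH] wS.
    rewrite big_nil; suff -> : fp_inr 1 = 1 by [].
    apply/fp_piP; exact: fp_inr1.
  rewrite big_cons fp_inrD; apply: GM.
    by apply: GS; rewrite mem_cat map_f ?orbT // wS // mem_head.
  by apply: IH => x xw; apply: wS; rewrite inE xw orbT.
elim/fp_ind; elim=> [|x u IH]; first exact: G1.
by rewrite -cat1s -fp_mulgE; apply: GM.
Qed.

(** ** The action of a free product defined by actions of its factors *)

Section Universal.
Variables (P : Type) (aG : G -> P -> P) (aH : H -> P -> P).
Hypotheses (aG1 : forall x, aG 1 x = x) (aH1 : forall x, aH 1 x = x).
Hypothesis aGM : forall g g' x, aG (g * g') x = aG g (aG g' x).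
Hypothesis aHM : forall h h' x, aH (h * h') x = aH h (aH h' x).

Definition letter_act (y : G + H) : P -> P :=
  match y with inl g => aG g | inr h => aH h end.

Definition word_act (u : seq (G + H)) (x : P) : P := foldr letter_act x u.

Lemma word_act_equiv u v : fp_equiv u v -> forall x, word_act u x = word_act v x.
Proof.
elim=> //=.
- by move=> v1 u1 w1 _ IH _ IH' x; rewrite IH IH'.
- move=> u1 u2 v1 v2 _ IH _ IH' x; rewrite /word_act !foldr_cat.
  by rewrite -/(word_act v1 x) -/(word_act v2 x) IH'; exact: IH.
Qed.

Definition fp_act (p : GH) : P -> P := word_act (generic_quotient.repr p).

Lemma fp_act1 x : fp_act 1 x = x.
Proof. by rewrite /fp_act (word_act_equiv (fp_reprK _)). Qed.

Lemma fp_actM p q x : fp_act (p * q) x = fp_act p (fp_act q x).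
Proof. by rewrite /fp_act (word_act_equiv (fp_reprK _)) /word_act foldr_cat. Qed.

Lemma fp_act_inl g x : fp_act (fp_inl g) x = aG g x.
Proof. by rewrite /fp_act (word_act_equiv (fp_reprK _)). Qed.

Lemma fp_act_inr h x : fp_act (fp_inr h) x = aH h x.
Proof. by rewrite /fp_act (word_act_equiv (fp_reprK _)). Qed.

End Universal.

(** ** An element of infinite order

    If tau in G moves a point p0 of some G-set Y and h in H is not trivial, then
    the product of tau and a conjugate of tau by h has infinite order.  Instead
    of normal forms, the proof uses an action on P = nat * Y * H in which a
    point escapes to infinity.  The factor
    G acts on the second component of P and H by left translations of the third
    one, conjugated by an involution that glues the i-th copy of Y * H to the
    next one: it exchanges (i, p1, h) or (i, p1, h^-1), according to the parity
    of i, with (i + 1, p0, 1).  So h or h^-1 sends (i, p1, 1) to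
    (i + 1, p0, 1), which tau moves to (i + 1, p1, 1). *)

Section InfiniteOrder.
Variables (Y : eqType) (a : gset G Y) (tau : G) (h : H) (p0 p1 : Y).
Hypotheses (tau01 : a tau p0 = p1) (p01 : p0 != p1) (h1 : h != 1).

Let P := (nat * Y * H)%type.

Let e (i : nat) : H := if odd i then h^-1 else h.

Let glue (v : P) : P :=
  let: (i, y, k) := v in
  if (y == p1) && (k == e i) then (i.+1, p0, 1)
  else if [&& y == p0, k == 1 & 0 < i] then (i.-1, p1, e i.-1) else v.

Let glueK : involutive glue.
Proof.
case=> [[i y] k]; rewrite /glue.
case: ifP => [/andP[/eqP-> /eqP->]|nb]; first by rewrite (negPf p01) !eqxx.
case: ifP => [/and3P[/eqP-> /eqP-> i0]|na]; first by rewrite !eqxx prednK.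
by rewrite nb na.
Qed.

Let aG (g : G) (v : P) : P := let: (i, y, k) := v in (i, a g y, k).
Let aH (k' : H) (v : P) : P :=
  glue (let: (i, y, k) := glue v in (i, y, k' * k)).

Definition zigzag : GH :=
  fp_inl tau * ((fp_inr h)^-1 * fp_inl tau * fp_inr h).

Lemma zigzag_expg_neq1 n : 0 < n -> zigzag ^+ n != 1.
Proof.
move=> n0.
have aG1 v : aG 1 v = v by case: v => [[i y] k]; rewrite /aG gset_act1.
have aGM g g' v : aG (g * g') v = aG g (aG g' v).
  by case: v => [[i y] k]; rewrite /aG gset_actM.
have aH1 v : aH 1 v = v.
  by rewrite /aH -[RHS]glueK; case: (glue v) => [[i y] k]; rewrite mul1g.
have aHM k k' v : aH (k * k') v = aH k (aH k' v).
  by rewrite /aH glueK; case: (glue v) => [[i y] k'']; rewrite mulgA.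
have hV1 : h^-1 != 1 by rewrite invg_eq1.
have e1 i : (1 == e i) = false.
  by rewrite /e eq_sym; case: odd; apply/negbTE.
have p10 : (p1 == p0) = false by rewrite eq_sym; apply/negbTE.
have zE i : ~~ odd i -> fp_act aG aH zigzag (i, p1, 1) = (i.+2, p1, 1).
  move=> ev; have actM := fp_actM aG1 aH1 aGM aHM.
  have step k : aH (e k) (k, p1, 1) = (k.+1, p0, 1).
    by rewrite /aH /glue e1 p10 !andbF /= mulg1 !eqxx.
  have invE : (fp_inr h)^-1 = fp_inr h^-1.
    apply: (mulIg (fp_inr h)); rewrite mulVg -fp_inrD mulVg.
    by apply/esym/fp_piP; exact: fp_inr1.
  rewrite /zigzag invE !actM.
  have ei : e i = h by rewrite /e (negPf ev).
  have ei1 : e i.+1 = h^-1 by rewrite /e /= ev.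
  have := step i; have := step i.+1; rewrite ei ei1 => step1 step0.
  have tE k : aG tau (k, p0, 1) = (k, p1, 1) by rewrite /aG tau01.
  by rewrite !(fp_act_inr aG1 aH1 aGM aHM) !(fp_act_inl aG1 aH1 aGM aHM) step0 tE step1 tE.
have zX m : fp_act aG aH (zigzag ^+ m) (0%N, p1, 1) = (m.*2, p1, 1).
  elim: m => [|m IH]; first by rewrite expg0 (fp_act1 aG1 aH1 aGM aHM).
  by rewrite expgS (fp_actM aG1 aH1 aGM aHM) IH zE ?odd_double.
apply/negP => /eqP zn; have := zX n; rewrite zn (fp_act1 aG1 aH1 aGM aHM).
by move=> -[] /esym/eqP; rewrite double_eq0 => /eqP n00; rewrite n00 in n0.
Qed.

End InfiniteOrder.
End FreeProductTheory.

(** * Growth of the free product *)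

Lemma maxset_natP (A : set nat) (K m : nat) :
  (forall k, A k -> k <= K) -> A m -> m <= maxset_nat A.
Proof.
move=> AK Am; rewrite /maxset_nat.
have exA : exists k, `[< A k >] by exists m; apply/asboolP.
have bndA k : `[< A k >] -> k <= K by move/asboolP/AK.
case: xgetP => [k _ [_ kmax]|nomax]; first exact: kmax.
have [k /asboolP Ak kmax] := ex_maxnP exA bndA.
by case: (nomax k); split=> // l Al; apply: kmax; apply/asboolP.
Qed.

(** The cardinals in the definition of the volume are bounded by the number of
    words of length at most n, hence so is their maximum. *)
Lemma vol_ge (L : groupType) (S : seq L) (X : choiceType) (a : gset L X) n x
    (s : seq X) :
  uniq s -> (forall y, y \in s -> exists2 g, ball S n g & y = a g x) ->
  size s <= vol S a n.
Proof.
move=> us sx.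
pose bl : seq L := iter n (fun t => 1 :: [seq b * g | b <- S, g <- t]) [:: 1].
have ball_bl g : ball S n g -> g \in bl.
  case=> w [wn wS] <-; rewrite /bl.
  elim: n w wn wS {sx bl} => [|n IH] [|b w] //= wn wS; rewrite ?big_nil ?mem_head //.
  rewrite inE big_cons; apply/orP; right; apply/allpairsP.
  exists (b, \prod_(i <- w) i); split=> //=; first by rewrite wS ?mem_head.
  by apply: IH => // c cw; apply: wS; rewrite inE cw orbT.
have orb y : ([set a g y | g in ball S n] `<=` [set` [seq a g y | g <- bl]])%classic.
  by move=> _ [g /ball_bl gbl <-] /=; apply: map_f.
have fin y : finite_set [set a g y | g in ball S n]%classic.
  by apply: sub_finite_set (orb y) _; exact: finite_seq.
apply: (@leq_trans #|` fset_set [set a g x | g in ball S n]%classic|%fset).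
  apply: uniq_leq_size => // y /sx[g gb ->].
  by rewrite in_fset_set //; apply/mem_set; exists g.
apply: (@maxset_natP _ (size bl)); last by exists x.
move=> _ [y _ <-]; rewrite -(size_map (fun g => a g y)).
apply: uniq_leq_size; first exact: fset_uniq.
by move=> v; rewrite in_fset_set // => /set_mem /orb.
Qed.

Lemma gset_VK (L : groupType) X (a : gset L X) g : cancel (a g) (a g^-1).
Proof. by move=> x; rewrite -gset_actM mulVg gset_act1. Qed.

Lemma gset_inj (L : groupType) X (a : gset L X) g : injective (a g).
Proof. exact: can_inj (gset_VK a g). Qed.

(** If every orbit of z had fewer than N points, then z^(N!) would act
    trivially. *)
Lemma long_orbit (L : groupType) (X : choiceType) (a : gset L X) (z : L) N :
  faithful_gset a -> (forall n, 0 < n -> z ^+ n != 1) ->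
  exists x, uniq [seq a (z ^+ k) x | k <- iota 0 N].
Proof.
move=> fa zn; apply: contrapT => /forallNP short.
have /eqP[] := zn _ (fact_gt0 N); apply: fa => x.
have /negP/(uniqPn x)[i [j [ij]]] := short x.
rewrite size_map size_iota => jN; have iN := ltn_trans ij jN.
rewrite !(nth_map 0%N) ?size_iota // !nth_iota // !add0n.
move=> E; have fx : a (z ^+ (j - i)) x = x.
  by apply: (@gset_inj _ _ a (z ^+ i)); rewrite -gset_actM -expgD subnKC 1?ltnW.
have /dvdnP[m ->] : j - i %| N`! by apply: dvdn_fact; lia.
rewrite mulnC expgM; elim: m => [|m IH]; first by rewrite expg0 gset_act1.
by rewrite expgS gset_actM IH.
Qed.

Section Growth.
Variables (r : nat) (H : groupType) (i j : 'I_r) (h : H).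
Hypotheses (ij : i != j) (h1 : h != 1).
Let L : groupType := free_product (houghton r) H.
Let p k := ray_pt i k.
Let tau : houghton r := hswap (p 0) (p 2) * hswap (p 0) (p 1).

Let tau01 : tau (p 0) = p 1.
Proof.
rewrite houghton_mulE /= /swap_fun eqxx.
by case: eqP => // _; case: eqP => // -[].
Qed.

Let houghton_gset : gset (houghton r) (xi_vertex r) :=
  @GSet (houghton r) (xi_vertex r) (fun g v => g v) (fun _ => erefl) (fun _ _ _ => erefl).

Variables (X : choiceType) (a : gset L X).
Hypothesis fa : faithful_gset a.

Let moves x : Prop := a (fp_inl H tau) x <> x.

(** Consecutive points x_k, x_(k+1) of a long orbit of tau * (h^-1 tau h) are
    distinct, so tau moves x_k or h x_k; one of the two alternatives holds for
    at least half of the values of k. *)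
Lemma moved_points n : exists x (Z : seq X), [/\ uniq Z, n <= size Z,
  {in Z, forall z, moves z} &
  {in Z, forall z, exists k, k <= 2 * n /\
    (z = a (zigzag tau h ^+ k) x \/ z = a (fp_inr _ h * zigzag tau h ^+ k) x)}].
Proof.
have zn m : 0 < m -> zigzag tau h ^+ m != 1.
  by apply: (@zigzag_expg_neq1 _ _ _ houghton_gset tau h (p 0) (p 1)).
have [x ux] := long_orbit (2 * n).+1 fa zn; exists x.
pose f k := a (zigzag tau h ^+ k) x.
have f_inj : {in iota 0 (2 * n).+1 &, injective f}.
  have /mkseq_uniqP finj := ux.
  by move=> k l; rewrite !mem_iota; exact: finj.
pose I1 := [seq k <- iota 0 (2 * n) | `[< moves (f k) >]].
pose I2 := [seq k <- iota 0 (2 * n) | `[< moves (a (fp_inr _ h) (f k)) >]].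
have sub k : k \in iota 0 (2 * n) -> k \in iota 0 (2 * n).+1.
  by rewrite !mem_iota; lia.
have I12 : 2 * n <= size I1 + size I2.
  rewrite !size_filter -count_predUI.
  apply: leq_trans (leq_addr _ _); rewrite -{1}(size_iota 0 (2 * n)) leq_eqVlt.
  rewrite eq_sym -all_count; apply/orP; left; apply/allP => k kn.
  rewrite /= -implyNb; apply/implyP => /asboolPn/contrapT fix1.
  apply/asboolP => fix2; have := f_inj k k.+1 (sub k kn).
  suff -> : f k.+1 = f k.
    by move: kn; rewrite !mem_iota => kn /(_ ltac:(lia) erefl)/eqP; rewrite ltn_eqF.
  rewrite /f expgS gset_actM -/(f k) /zigzag !gset_actM fix2.
  by rewrite (gset_VK a (fp_inr _ h)) fix1.
have uI1 : uniq I1 by rewrite filter_uniq ?iota_uniq.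
have uI2 : uniq I2 by rewrite filter_uniq ?iota_uniq.
have sI1 k : k \in I1 -> k \in iota 0 (2 * n) by rewrite mem_filter => /andP[].
have sI2 k : k \in I2 -> k \in iota 0 (2 * n) by rewrite mem_filter => /andP[].
have [nI1|nI1] := leqP n (size I1).
  exists [seq f k | k <- I1]; split.
  - by rewrite map_inj_in_uniq // => k l /sI1/sub kI /sI1/sub lI; exact: f_inj.
  - by rewrite size_map.
  - by move=> _ /mapP[k + ->]; rewrite mem_filter => /andP[/asboolP].
  - move=> _ /mapP[k /sI1 kI ->]; exists k; split; last by left.
    by move: kI; rewrite mem_iota; lia.
exists [seq a (fp_inr _ h) (f k) | k <- I2]; split.
- rewrite map_inj_in_uniq // => k l /sI2/sub kI /sI2/sub lI E.
  by apply: f_inj => //; exact: (gset_inj E).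
- by rewrite size_map; lia.
- by move=> _ /mapP[k + ->]; rewrite mem_filter => /andP[/asboolP].
- move=> _ /mapP[k /sI2 kI ->]; exists k; split.
    by move: kI; rewrite mem_iota; lia.
  by right; rewrite gset_actM.
Qed.

(** The permutations of the first 12 n + 1 vertices of a ray act on X, and the
    transpositions among them have word length O(n); the n^2 points given by
    these permutations from the n moved points are all in one ball of radius
    O(n). *)
Lemma quadratic_growth (S : seq L) : symmetric_generating S ->
  growth_le (fun n => (n ^ 2)%N) (vol S a).
Proof.
move=> Ssym.
have [C Cswap] := ball_swap (@fp_inlD (houghton r) H) Ssym ij.
have [mh hm] := Ssym.2 (fp_inr _ h); have [mz zm] := Ssym.2 (zigzag tau h).
pose D := (39 * C + mh + 2 * mz).+1.
exists D; split=> // n n0.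
have [x [Z [uZ nZ mZ Zx]]] := moved_points n.
pose q := (12 * n)%N.
pose ra (y : X) (s : {perm 'I_q.+1}) := a (fp_inl H (emb i s)) y.
have inl1 : fp_inl H 1 = 1 :> L := morph_one (@fp_inlD (houghton r) H).
have ra1 y : ra y 1 = y by rewrite /ra emb1 inl1 gset_act1.
have raM y s t : ra y (s * t) = ra (ra y s) t by rewrite /ra embM fp_inlD gset_actM.
have tauE : emb i (cyc3 (inord 0) (inord 1) (inord 2) : {perm 'I_q.+1}) = tau.
  rewrite embM !emb_tperm !inordK //; lia.
have mZ' : {in Z, forall z, ra z (cyc3 (inord 0) (inord 1) (inord 2)) <> z}.
  by move=> z zZ; rewrite /ra tauE; exact: mZ.
have [s [us ns sZ]] := many_points n0 ra1 raM uZ nZ mZ'.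
apply: (@leq_trans (vol S a (D * n))); last by rewrite leq_pmull.
apply: leq_trans ns _; apply: (vol_ge us (x := x)) => y /sZ[z zZ [l l3 ->]].
have wl : ball S (size l * (C * q + C)) (fp_inl H (emb i (tperm_word l))).
  elim: l {l3} => [|[b c] l IH].
    by rewrite /tperm_word big_nil emb1 inl1 mul0n; exact: ball_one.
  rewrite /tperm_word big_cons embM fp_inlD /= mulSn addnC.
  by apply: ball_mul IH _; rewrite emb_tperm; apply: Cswap; rewrite -ltnS.
have {}wl : ball S (39 * C * n) (fp_inl H (emb i (tperm_word l))).
  apply: ball_mono wl; apply: (@leq_trans (3 * (C * q + C))).
    by rewrite leq_mul2r l3 orbT.
  by rewrite /q; nia.
have [k [kn zE]] := Zx z zZ.
have zk : ball S (2 * mz * n) (zigzag tau h ^+ k).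
  by apply: ball_mono (ball_exp k zm); nia.
have [g gb ->] : exists2 g, ball S (mh * n + 2 * mz * n) g & z = a g x.
  case: zE => ->; last first.
    eexists; last reflexivity; apply: ball_mul zk.
    by apply: ball_mono hm; nia.
  by eexists; last reflexivity; apply: ball_mono zk; lia.
exists (fp_inl H (emb i (tperm_word l)) * g); last by rewrite gset_actM.
by apply: ball_mono (ball_mul wl gb); rewrite /D; nia.
Qed.

End Growth.

Theorem theorem1p5 (r : nat) (H : groupType) :
  (2 <= r)%N ->
  (exists h : H, h <> 1%g) ->
  finitely_generated H ->
  schreier_growth_gap (free_product (houghton r) H) (fun n => (n ^ 2)%N).
Proof.
move=> r2 [h /eqP h1] fgH; split; first exact: free_product_fg (houghton_fg r2) fgH.
move=> S Ssym X a fa; case: r r2 S Ssym a fa => [|[|r]] // _ S Ssym a fa.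
by apply: (@quadratic_growth _ _ ord0 (lift ord0 ord0) h).
Qed.
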